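(* Let $\varrho$ be a substitution on a compact Hausdorff alphabet $\mathcal{A}$. Suppose that $\varrho$ is primitive, of constant length $L$, and that the semigroup $\Phi$ generated by its columns is equicontinuous. Then $T=M/r$ is strongly power convergent and the tiling dynamical system $(\Omega,\mathbb{R})$ associated with $\varrho$ is uniquely ergodic.
   Context: Substitutions. $\mathcal{A}$ is a compact Hausdorff space; $\mathcal{A}^+=\bigsqcup_{n\ge1}\mathcal{A}^n$ is the space of non-empty finite words (disjoint union of product topologies), $\mathcal{A}^*=\mathcal{A}^+\sqcup\{\varepsilon\}$. A substitution is a continuous map $\varrho\colon\mathcal{A}\to\mathcal{A}^+$, extended to words by concatenation and iterated. Standing assumption: some letter has $|\varrho(a)|\ge2$. $\varrho$ has constant length $L$ if $|\varrho(a)|=L$ for all $a$; then $\varrho(a)=\varrho_1(a)\cdots\varrho_L(a)$ with continuous maps $\varrho_i\colon\mathcal{A}\to\mathcal{A}$ called columns. $\Phi$ is the semigroup (under composition) generated by $\varrho_1,\dots,\varrho_L$; it is called equicontinuous if it is a uniformly equicontinuous family of maps with respect to the unique uniformity of the compact Hausdorff space $\mathcal{A}$. Primitive: for every non-empty open $U\subseteq\mathcal{A}$ there is $p\ge0$ such that for all $a\in\mathcal{A}$ some letter of $\varrho^p(a)$ is in $U$. Operator. $E=C(\mathcal{A})$ (continuous real functions, supremum norm); $(Mf)(a)=\sum_{b\triangleleft\varrho(a)}f(b)$, summing over all letters of $\varrho(a)$ with multiplicity; $r$ is the spectral radius of $M$ (here $r=L$). $T$ is strongly power convergent if $\lim_n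 T^n(f)$ exists in $E$ for every $f\in E$. Dynamical system. A word is generated by $\varrho$ if it is a subword of some $\varrho^k(a)$, $a\in\mathcal{A}$, $k\ge0$; $\mathcal{L}(\varrho)\subseteq\mathcal{A}^*$ is the closure of the set of generated words; $X_\varrho\subseteq\mathcal{A}^{\mathbb{Z}}$ is the set of bi-infinite sequences all of whose finite subwords lie in $\mathcal{L}(\varrho)$, with shift $\sigma(x)_i=x_{i+1}$. A natural length function is a non-zero, non-negative $\ell\in E$ with $M\ell=\lambda\ell$ for some $\lambda\ge0$; in the constant length case the constant function $\ell=\mathbf{1}$ is one. $\Omega$ is the space of tilings of $\mathbb{R}$ by translates of labelled intervals $[0,\ell(a)]$, $a\in\mathcal{A}$, whose label sequence lies in $X_\varrho$, with $\mathbb{R}$ acting by translation; it is identified with $(X_\varrho\times\mathbb{R})/\!\sim$, where $\sim$ is generated by $(x,s+\ell(x_0))\sim(\sigma(x),s)$ ($x\in X_\varrho$, $s\in\mathbb{R}$), with action $t\cdot[(x,s)]=[(x,s-t)]$. Uniquely ergodic means there is exactly one invariant regular Borel probability measure. *)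

(* Defs.v *)
From HB Require Import structures.
From Stdlib Require Import Relations.
From mathcomp Require Import all_boot all_order all_algebra generic_quotient.
From mathcomp Require Import complex.
From mathcomp Require Import all_classical all_reals all_analysis.

Set Implicit Arguments.
Unset Strict Implicit.
Unset Printing Implicit Defensive.

Import Order.TTheory GRing.Theory Num.Theory.
Import numFieldNormedType.Exports.

Local Open Scope classical_set_scope.
Local Open Scope ring_scope.
Local Open Scope quotient_scope.

(** The word spaces A^* and A^+, topologized as disjoint unions of finite
    powers of A. *)
Definition word (A : topologicalType) := {n : nat & {ptws 'I_n -> A}}.

Definition nonempty_word (A : topologicalType) :=
  {n : nat & {ptws 'I_n.+1 -> A}}.

Definition letters (A : topologicalType) (w : word A) : seq A :=
  codom (projT2 w).

Section Substitution.
Context {A : topologicalType} (rho : A -> nonempty_word A).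

Definition subst_letter (a : A) : seq A := codom (projT2 (rho a)).

Definition subst_seq (s : seq A) : seq A := flatten (map subst_letter s).

Definition subst_iter (k : nat) (a : A) : seq A := iter k subst_seq [:: a].

Definition constant_length (L : nat) : Prop :=
  forall a : A, size (subst_letter a) = L.

Definition primitive : Prop :=
  forall U : set A, open U -> U !=set0 ->
    exists p : nat, forall a : A, exists2 b, b \in subst_iter p a & U b.

(** The i-th column, counting from 0; the default value of nth is irrelevant
    for i < L when rho has constant length L. *)
Definition column (i : nat) (a : A) : A := nth a (subst_letter a) i.

Inductive column_semigroup (L : nat) : (A -> A) -> Prop :=
| column_semigroup_gen (i : 'I_L) : column_semigroup L (column i)
| column_semigroup_comp (f g : A -> A) :
    column_semigroup L f -> column_semigroup L g ->
    column_semigroup L (f \o g).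

Definition subst_op {V : nmodType} (f : A -> V) : A -> V :=
  fun a => \sum_(b <- subst_letter a) f b.

Definition generated : set (word A) :=
  [set w | exists (k : nat) (a : A), infix (letters w) (subst_iter k a)].

Definition language : set (word A) := closure generated.

Definition subshift : set {ptws int -> A} :=
  [set x | forall (i : int) (n : nat),
    language (existT (fun m => {ptws 'I_m -> A}) n
                     (fun j : 'I_n => x (i + j%:Z)))].

End Substitution.

Definition shift {A : Type} (x : int -> A) : int -> A := fun i => x (i + 1).

(** For a compact Hausdorff space the entourages of a uniformType are those of
    the unique uniformity inducing the topology. *)
Definition uniformly_equicontinuous {A : uniformType} (F : set (A -> A)) :=
  forall E : set (A * A), entourage E ->
    exists2 D : set (A * A), entourage D &
      forall f x y, F f -> D (x, y) -> E (f x, f y).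

Section Operator.
Context {R : realType} {A : topologicalType}.

Definition ccontinuous (h : A -> R[i]) : Prop :=
  continuous (fun a => complex.Re (h a)) /\
  continuous (fun a => complex.Im (h a)).

(** Spectrum and spectral radius of an operator on C(A), taken on its
    complexification C(A; C): N is the operator on complex functions. An
    everywhere defined bounded operator is invertible iff it is bijective. *)
Definition spectrum (N : (A -> R[i]) -> (A -> R[i])) : set R[i] :=
  [set z | ~ (forall k, ccontinuous k ->
     exists! h, ccontinuous h /\ (fun a => z * h a - N h a) = k)].

Definition spectral_radius (N : (A -> R[i]) -> (A -> R[i])) : R :=
  sup [set complex.Re `|z| | z in spectrum N].

(** Uniform convergence is convergence for the supremum norm. *)
Definition strongly_power_convergent (T : (A -> R) -> (A -> R)) : Prop :=
  forall f : A -> R, continuous f -> exists g : A -> R,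
    continuous g /\ {uniform, (fun n => iter n T f) @ \oo --> g}.

Definition natural_length (rho : A -> nonempty_word A) (l : A -> R) : Prop :=
  [/\ continuous l, (forall a, 0 <= l a), (exists a, l a != 0) &
      exists2 lambda : R, 0 <= lambda &
        forall a, subst_op rho l a = lambda * l a].

End Operator.

Section TilingSpace.
Context {R : realType} {A : topologicalType}.
Variables (rho : A -> nonempty_word A) (l : A -> R).

Definition suspension := (subshift rho * R)%type.

Definition suspension_step (p q : suspension) : Prop :=
  set_val q.1 = shift (set_val p.1) /\ p.2 = q.2 + l (set_val p.1 0).

Definition suspension_rel (p q : suspension) : bool :=
  `[< clos_refl_sym_trans suspension suspension_step p q >].

Lemma suspension_rel_refl : reflexive suspension_rel.
Proof. by move=> p; apply/asboolP; exact: rst_refl. Qed.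

Lemma suspension_rel_sym : symmetric suspension_rel.
Proof.
by move=> p q; apply/idP/idP => /asboolP pq; apply/asboolP; exact: rst_sym.
Qed.

Lemma suspension_rel_trans : transitive suspension_rel.
Proof.
move=> q p r /asboolP pq /asboolP qr; apply/asboolP.
exact: rst_trans pq qr.
Qed.

Canonical suspension_equiv :=
  EquivRel suspension_rel suspension_rel_refl suspension_rel_sym
    suspension_rel_trans.

Definition tiling_space :=
  quotient_topology {eq_quot suspension_equiv}.

Definition tiling_class (p : suspension) : tiling_space :=
  \pi_({eq_quot suspension_equiv}) p.

Definition translate (t : R) (w : tiling_space) : tiling_space :=
  let p := repr (w : {eq_quot suspension_equiv}) in tiling_class (p.1, p.2 - t).

Lemma translateE (t : R) (x : subshift rho) (s : R) :
  translate t (tiling_class (x, s)) = tiling_class (x, s - t).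
Proof.
suff H (p q : suspension) : suspension_rel p q ->
    suspension_rel (p.1, p.2 - t) (q.1, q.2 - t).
  rewrite /translate /tiling_class; apply/eqmodP => /=.
  apply: (H _ (x, s)); rewrite -/(suspension_equiv _ _) -eqmodE.
  by rewrite reprK.
move=> /asboolP pq; apply/asboolP; elim: pq => {p q}.
- move=> p q [xE sE]; apply: rst_step; split => //=.
  by rewrite sE addrAC.
- by move=> p; exact: rst_refl.
- by move=> p q _; exact: rst_sym.
- by move=> p q r _ pq _ qr; exact: rst_trans pq qr.
Qed.

End TilingSpace.

(** The library's measurable types are pointed, whence the base point x0 below;
    the Borel sets do not depend on it. *)
Definition pointed_at (T : topologicalType) (x0 : T) : Type := T.
HB.instance Definition _ (T : topologicalType) (x0 : T) :=
  Topological.on (pointed_at x0).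
HB.instance Definition _ (T : topologicalType) (x0 : T) :=
  isPointed.Build (pointed_at x0) x0.

Definition borel_at (T : topologicalType) (x0 : T) :=
  g_sigma_algebraType (open : set (set (pointed_at x0))).

Section Ergodicity.
Context {R : realType} {T : topologicalType}.

Definition regular_measure (x0 : T) (mu : probability (borel_at x0) R) : Prop :=
  forall B : set (borel_at x0), measurable B ->
    mu B = ereal_inf [set mu U | U in [set U : set T | open U /\ B `<=` U]] /\
    mu B = ereal_sup [set mu K | K in [set K : set T | compact K /\ K `<=` B]].

Definition invariant_measure (act : R -> T -> T) (x0 : T)
    (mu : probability (borel_at x0) R) : Prop :=
  forall (t : R) (B : set (borel_at x0)), measurable B ->
    mu (act t @^-1` B) = mu B.

(** Members of probability are functions on all sets, so uniqueness is stated
    on Borel sets. *)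
Definition uniquely_ergodic (act : R -> T -> T) : Prop :=
  exists (x0 : T) (mu : probability (borel_at x0) R),
    [/\ regular_measure mu, invariant_measure act mu &
        forall nu : probability (borel_at x0) R,
          regular_measure nu -> invariant_measure act nu ->
          forall B : set (borel_at x0), measurable B -> nu B = mu B].

End Ergodicity.

(* Main.v *)
Require Import Defs.
From Stdlib Require Import Relations.
From mathcomp Require Import all_boot all_order all_algebra.
From mathcomp Require Import complex generic_quotient.
From mathcomp Require Import all_classical all_reals all_analysis.
From HB Require Import structures.
From mathcomp Require Import measurable_realfun.
From mathcomp Require Import ring lra zify.
Import Order.TTheory GRing.Theory Num.Theory.
Import numFieldNormedType.Exports.
Local Open Scope classical_set_scope.
Local Open Scope ring_scope.
Set Implicit Arguments.
Unset Strict Implicit.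
Unset Printing Implicit Defensive.

(** Since the columns are equicontinuous, all means [T^n h] of a continuous
    [h] share one modulus of continuity, and by primitivity the letters below
    every [a] come close to a point where [T^n h] is small; hence the
    oscillation of [T^n h] tends to 0 and [T^n h] converges uniformly to a
    constant.  The spectral radius is [L], because the constants are
    eigenvectors and a Neumann series inverts [z - M] for [|z| > L].  In
    particular a natural length function is a constant [c].

    A word of the subshift is, up to its ends, a concatenation of blocks
    [rho^p(b)].  The mean of an observable over the block [rho^(p+q)(b)] is
    close to [T^q h_p] with [h_p b] its mean over [rho^p(b)], so it hardly
    depends on [b], and Birkhoff sums over the subshift converge uniformly to
    a constant.  On the tiling space this makes the averages of a continuous
    function over a fine grid of times nearly constant.  The common value of
    such averages is a positive invariant functional; its Riesz measure is
    invariant, and any invariant regular measure agrees with it on open sets. *)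

(** * Borel measures from positive linear functionals *)

(** The place where [T^n h] is small moves with [n], so closeness must be uniform: equicontinuity
    gives one entourage for all [n], and compactness upgrades primitivity to one exponent [P] for
    all target points. The letter that comes close has weight [1 / L^P] in the mean, whatever [n]
    is, so every drop of the maximum is by a fixed amount.

    A natural length function satisfies [T^n l = q^n l] with [q] unknown at first. It is constant
    because [T^n l] becomes flat while primitivity keeps [q^n] away from 0.

    Growth gives [L >= 2]. Hence block lengths tend to infinity, and windows of radius [m]
    overlapping the ends of a block of length [L^p] contribute only an error of order [m / L^p].

    Time averages are finite means over lists of times instead of integrals. Two such means commute
    because the translations do, and the mean over a sumset is at least as good as both; this makes
    the limiting functional well defined and additive. *)

Section ContinuousFunctions.
Context {R : realType} {T : topologicalType}.
Implicit Types f g : T -> R.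

Lemma continuous_cst_fun (c : R) : continuous (fun _ : T => c).
Proof. by move=> x; exact: cvg_cst. Qed.

Lemma continuous_addf f g : continuous f -> continuous g ->
  continuous (fun x => f x + g x).
Proof. by move=> cf cg x; apply: cvgD; [exact: cf|exact: cg]. Qed.

Lemma continuous_subf f g : continuous f -> continuous g ->
  continuous (fun x => f x - g x).
Proof. by move=> cf cg x; apply: cvgB; [exact: cf|exact: cg]. Qed.

Lemma continuous_mulf f g : continuous f -> continuous g ->
  continuous (fun x => f x * g x).
Proof. by move=> cf cg x; apply: cvgM; [exact: cf|exact: cg]. Qed.

Lemma continuous_maxf f g : continuous f -> continuous g ->
  continuous (fun x => Num.max (f x) (g x)).
Proof.
by move=> cf cg x; apply: continuous_max; [exact: cf|exact: cg].
Qed.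

Lemma continuous_sumf (I : Type) (s : seq I) (F : I -> T -> R) :
  (forall i, continuous (F i)) -> continuous (fun x => \sum_(i <- s) F i x).
Proof.
move=> cF; elim: s => [|i s ih].
  rewrite (_ : (fun _ => _) = (fun _ => 0)); first exact: continuous_cst_fun.
  by apply/funext => x; rewrite big_nil.
rewrite (_ : (fun _ => _) = (fun x => F i x + \sum_(j <- s) F j x)).
  exact: continuous_addf.
by apply/funext => x; rewrite big_cons.
Qed.

Lemma compact_bounded_fun f : compact [set: T] -> continuous f ->
  exists2 M : R, 0 < M & forall x, `|f x| <= M.
Proof.
move=> Tc cf.
have : compact (f @` [set: T]).
  by apply: continuous_compact => //; exact: continuous_subspaceT.
move=> /compact_bounded[M [_ HM]]; exists (Num.max (M + 1) 1).
  by rewrite lt_max ltr01 orbT.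
move=> x; apply: (HM (Num.max (M + 1) 1)); last by exists x.
by rewrite lt_max ltrDl ltr01.
Qed.

Lemma open_lt_fun f (e : R) : continuous f -> open [set x | f x < e].
Proof. by move=> cf; apply: (@open_comp T R f [set y | y < e]) => //; exact: open_lt. Qed.

Lemma closed_ge_fun f (e : R) : continuous f -> closed [set x | e <= f x].
Proof. by move=> cf; apply: (@preimage_closed T R f [set y | e <= y]) => //; exact: closed_ge. Qed.

Lemma compact_hausdorff_bump (K U : set T) :
  compact [set: T] -> hausdorff_space T -> closed K -> open U -> K `<=` U ->
  exists f, [/\ continuous f, (forall x, 0 <= f x <= 1),
    (forall x, K x -> f x = 1) & (forall x, ~ U x -> f x = 0)].
Proof.
move=> Tc Th cK oU KU.
have nT : normal_space T by exact: compact_normal.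
have [||f [cf f0 f1 fr]] := @urysohn_ext_itv T R nT (~` U) K 0 1 _ cK _ ltr01.
- by rewrite closedC.
- by apply/seteqP; split => x // -[/= nU /KU].
exists f; split => // x.
- by have := fr (f x) (ex_intro2 _ _ x I erefl); rewrite /= in_itv.
- by move=> Kx; apply: f1; exists x.
- by move=> Ux; apply: f0; exists x.
Qed.

End ContinuousFunctions.

Section Content.
Context {R : realType} {T : topologicalType}.
Variable Lam : (T -> R) -> R.

(** Vanishing off [U] stands in for compact support inside [U]. Cutting at a level [e > 0] bridges
    the two: the set where [e <= f] is closed, hence compact, and lies in [U], and the cut lowers
    the normalized functional by at most [e]. *)
Definition subordinate (U : set T) (f : T -> R) :=
  [/\ continuous f, (forall x, 0 <= f x <= 1) & (forall x, ~ U x -> f x = 0)].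

Definition open_content (U : set T) : \bar R :=
  ereal_sup [set (Lam f)%:E | f in subordinate U].

Definition content_measure (B : set T) : \bar R :=
  ereal_inf [set open_content U | U in [set U | open U /\ B `<=` U]].

Hypothesis Tc : compact [set: T].
Hypothesis Th : hausdorff_space T.
Hypothesis LamD : forall f g, continuous f -> continuous g ->
  Lam (fun x => f x + g x) = Lam f + Lam g.
Hypothesis Lam_le : forall f g, continuous f -> continuous g ->
  (forall x, f x <= g x) -> Lam f <= Lam g.
Hypothesis Lam_cst : forall c, Lam (fun=> c) = c.

Local Notation mu := content_measure.
Local Open Scope ereal_scope.

Lemma subordinate0 (U : set T) : subordinate U (fun=> 0%R).
Proof.
split => //; first exact: continuous_cst_fun.
by move=> _; rewrite lexx ler01.
Qed.

Lemma content_ge (U : set T) (f : T -> R) : subordinate U f -> (Lam f)%:E <= open_content U.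
Proof. by move=> Uf; apply: ereal_sup_ubound; exists f. Qed.

Lemma content_ge0 (U : set T) : 0 <= open_content U.
Proof. by have := content_ge (subordinate0 U); rewrite Lam_cst. Qed.

Lemma content_le1 (U : set T) : open_content U <= 1.
Proof.
apply: ge_ereal_sup => _ [f [cf f01 _] <-]; rewrite lee_fin.
rewrite -(Lam_cst 1%R); apply: Lam_le => //; first exact: continuous_cst_fun.
by move=> x; case/andP: (f01 x).
Qed.

Lemma content_fin (U : set T) : open_content U \is a fin_num.
Proof.
by rewrite ge0_fin_numE ?content_ge0// (le_lt_trans (content_le1 U))// ltry.
Qed.

Lemma content_mono (U V : set T) : U `<=` V -> open_content U <= open_content V.
Proof.
move=> UV; apply: le_ereal_sup => _ [f [cf f01 fU] <-]; exists f => //.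
by split => // x nV; apply: fU => /UV.
Qed.

Lemma content_set0 : open_content set0 = 0.
Proof.
apply/eqP; rewrite eq_le content_ge0 andbT; apply: ge_ereal_sup => _ [f [cf _ f0] <-].
rewrite (_ : f = fun=> 0%R) ?Lam_cst//.
by apply/funext => x; exact: f0.
Qed.

Lemma content_setT : open_content setT = 1.
Proof.
apply/eqP; rewrite eq_le content_le1 /= -(Lam_cst 1%R); apply: content_ge.
split => //; [exact: continuous_cst_fun|by move=> x; rewrite ler01 lexx|].
by move=> x; case.
Qed.

Lemma subordinate_cut (U : set T) (f : T -> R) (e : R) : (0 <= e)%R ->
  continuous f -> (forall x, 0 <= f x <= 1)%R ->
  (forall x, ~ U x -> f x <= e)%R ->
  subordinate U (fun x => Num.max (f x - e) 0)%R.
Proof.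
move=> e0 cf f01 fU; split.
- apply: continuous_maxf; last exact: continuous_cst_fun.
  by apply: continuous_subf => //; exact: continuous_cst_fun.
- move=> x; case/andP: (f01 x) => f0 f1; rewrite le_max lexx orbT /= ge_max ler01 andbT.
  by rewrite lerBlDr (le_trans f1)// lerDl.
- by move=> x /fU fe; apply/max_idPr; rewrite subr_le0.
Qed.

Lemma Lam_cut (f : T -> R) (e : R) : continuous f ->
  (Lam f <= Lam (fun x => Num.max (f x - e) 0) + e)%R.
Proof.
move=> cf; rewrite -[X in (_ <= _ + X)%R](Lam_cst e) -LamD.
- apply: Lam_le => //.
    apply: continuous_addf; last exact: continuous_cst_fun.
    apply: continuous_maxf; last exact: continuous_cst_fun.
    by apply: continuous_subf => //; exact: continuous_cst_fun.
  by move=> x; rewrite -lerBlDr le_max lexx.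
- apply: continuous_maxf; last exact: continuous_cst_fun.
  by apply: continuous_subf => //; exact: continuous_cst_fun.
- exact: continuous_cst_fun.
Qed.

Lemma content_setU (U V : set T) : open U -> open V ->
  open_content (U `|` V) <= open_content U + open_content V.
Proof.
move=> oU oV; apply: ge_ereal_sup => _ [f [cf f01 fUV] <-].
apply/lee_addgt0Pr => e e0.
(* With a bump [g] equal to 1 on [K] and 0 off [U], the function [f] splits into [f * g], which
   lives on [U], and [f * (1 - g)], which off [V] can be nonzero only where [f < e]. *)
pose K := [set x | (e <= f x)%R] `&` ~` V.
have cK : closed K by apply: closedI; [exact: closed_ge_fun|rewrite closedC].
have KU : K `<=` U.
  move=> x [/= ef nV]; apply: contrapT => nU; move: ef.
  by rewrite fUV ?leNgt ?e0// => -[].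
have [g [cg g01 gK gU]] := @compact_hausdorff_bump R T _ _ Tc Th cK oU KU.
pose f1 x := (f x * g x)%R; pose h x := (f x * (1 - g x))%R.
have cf1 : continuous f1 by exact: continuous_mulf.
have ch : continuous h.
  apply: continuous_mulf => //; apply: continuous_subf => //.
  exact: continuous_cst_fun.
have s1 : subordinate U f1.
  split => // x.
    case/andP: (f01 x) => ? ?; case/andP: (g01 x) => ? ?.
    by rewrite mulr_ge0//= mulr_ile1.
  by move=> nU; rewrite /f1 gU ?mulr0.
have s2 : subordinate V (fun x => Num.max (h x - e) 0)%R.
  apply: subordinate_cut => //; first exact: ltW.
    move=> x; case/andP: (f01 x) => ? ?; case/andP: (g01 x) => ? ?.
    by rewrite /h mulr_ge0 ?subr_ge0// mulr_ile1// ?subr_ge0// gerBl.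
  move=> x nV; rewrite /h; case: (leP e (f x)) => fe.
    by rewrite gK// subrr mulr0 ltW.
  case/andP: (f01 x) => ? ?; case/andP: (g01 x) => ? ?.
  by rewrite (le_trans _ (ltW fe))// ler_piMr// gerBl.
(* [h] is at most [e] off [V], so its cut at [e] is subordinate to [V]. *)
have -> : f = (fun x => f1 x + h x)%R.
  by apply/funext => x; rewrite /f1 /h -mulrDr addrC subrK mulr1.
rewrite LamD// EFinD -addeA; apply: leeD; first exact: content_ge.
apply: (@le_trans _ _ (Lam (fun x => Num.max (h x - e) 0)%R + e)%R%:E).
  by rewrite lee_fin; exact: Lam_cut.
by rewrite EFinD leeD2r//; exact: content_ge.
Qed.

Lemma content_bigsetU (U : (set T)^nat) n : (forall i, open (U i)) ->
  open_content (\big[setU/set0]_(i < n) U i) <= \sum_(i < n) open_content (U i).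
Proof.
move=> oU; elim: n => [|n ih]; first by rewrite !big_ord0 content_set0.
rewrite !big_ord_recr /=; apply: le_trans (leeD2r _ ih).
by apply: content_setU => //; rewrite -bigcup_mkord; exact: bigcup_open.
Qed.

Lemma compact_bigcup_finite (K : set T) (U : (set T)^nat) :
  compact K -> (forall i, open (U i)) -> K `<=` \bigcup_i U i ->
  exists n, K `<=` \big[setU/set0]_(i < n) U i.
Proof.
move=> /compact_near_coveringP Kc oU KU.
pose P n x := (\big[setU/set0]_(i < n) U i) x.
have : \forall n \near \oo, K `<=` P n.
  apply: Kc => x /KU[m _ Um]; exists (U m, [set n | (m < n)%N]).
    split => /=; last exact: nbhs_infty_gt.
    by apply: open_nbhs_nbhs; split => //; exact: oU.
  by move=> [y n] [/= Uy mn]; rewrite /P -bigcup_mkord; exists m.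
by move=> /filter_ex[n]; exists n.
Qed.

(** The level set of [f] at [e] is compact, so finitely many [U i] cover it and the cut of [f] at
    [e] is subordinate to their union. *)
Lemma content_bigcup (U : (set T)^nat) : (forall i, open (U i)) ->
  open_content (\bigcup_i U i) <= \sum_(i <oo) open_content (U i).
Proof.
move=> oU; apply: ge_ereal_sup => _ [f [cf f01 fU] <-].
apply/lee_addgt0Pr => e e0.
have cK : compact [set x | (e <= f x)%R].
  by apply: subclosed_compact Tc _ => //; exact: closed_ge_fun.
have [|n Kn] := compact_bigcup_finite cK oU.
  move=> x /= ef; apply: contrapT => nU; move: ef.
  by rewrite fU// leNgt e0.
apply: (@le_trans _ _ (Lam (fun x => Num.max (f x - e) 0)%R + e)%R%:E).
  by rewrite lee_fin; exact: Lam_cut.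
rewrite EFinD leeD2r//.
apply: (@le_trans _ _ (open_content (\big[setU/set0]_(i < n) U i))).
  apply: content_ge; apply: subordinate_cut => //; first exact: ltW.
  move=> x nU; rewrite leNgt; apply/negP => ef; apply: nU; apply: Kn.
  exact: ltW.
apply: le_trans (content_bigsetU _ oU) _.
rewrite -(big_mkord xpredT (fun i => open_content (U i))).
by apply: nneseries_lim_ge => i _ _; exact: content_ge0.
Qed.

Lemma content_measure_le (B U : set T) : open U -> B `<=` U -> mu B <= open_content U.
Proof. by move=> oU BU; apply: ereal_inf_lbound; exists U. Qed.

Lemma content_measure_open (U : set T) : open U -> mu U = open_content U.
Proof.
move=> oU; apply/eqP; rewrite eq_le content_measure_le//=.
by apply: le_ereal_inf_tmp => _ [V [oV UV] <-]; exact: content_mono.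
Qed.

Lemma content_measure_mono : {homo mu : A B / A `<=` B >-> A <= B}.
Proof.
move=> A B AB; apply: le_ereal_inf_tmp => _ [U [oU BU] <-].
by apply: content_measure_le => //; exact: subset_trans BU.
Qed.

Lemma content_measure_ge0 (B : set T) : 0 <= mu B.
Proof. by apply: le_ereal_inf_tmp => _ [U _ <-]; exact: content_ge0. Qed.

Lemma content_measure_le1 (B : set T) : mu B <= 1.
Proof.
by rewrite -content_setT; apply: content_measure_le => //; exact: openT.
Qed.

Lemma content_measure_fin (B : set T) : mu B \is a fin_num.
Proof.
rewrite ge0_fin_numE ?content_measure_ge0//.
by rewrite (le_lt_trans (content_measure_le1 B))// ltry.
Qed.

Lemma content_measure_adherent (B : set T) (e : R) : (0 < e)%R ->
  exists U, [/\ open U, B `<=` U & open_content U <= mu B + e%:E].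
Proof.
move=> e0; have [_ [U [oU BU] <-] Ue] := lb_ereal_inf_adherent e0 (content_measure_fin B).
by exists U; split => //; exact: ltW.
Qed.

Lemma content_measure_sigma_subadditive : sigma_subadditive mu.
Proof.
move=> F; apply/lee_addgt0Pr => e e0.
have /choice[U HU] : forall n, exists U,
    [/\ open U, F n `<=` U & open_content U <= mu (F n) + (e / (2 ^ n.+1)%:R)%:E].
  by move=> n; apply: content_measure_adherent; rewrite divr_gt0// ltr0n expn_gt0.
apply: (@le_trans _ _ (open_content (\bigcup_i U i))).
  apply: content_measure_le.
    by apply: bigcup_open => n _; have [] := HU n.
  by apply: subset_bigcup => n _; have [] := HU n.
apply: le_trans (content_bigcup _) _; first by move=> n; have [] := HU n.
apply: le_trans (epsilon_trick _ _ (ltW e0)).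
  apply: lee_nneseries => n _; first by move=> ?; exact: content_ge0.
  by have [] := HU n.
by move=> n; exact: content_measure_ge0.
Qed.

Definition content_outer_measure : {outer_measure set T -> \bar R} :=
  HB.pack mu (isOuterMeasure.Build R T mu
    (etrans (content_measure_open open0) content_set0)
    content_measure_ge0 content_measure_mono content_measure_sigma_subadditive).

(** Outer regularity reduces the test set [X] to an open [V]. Nearly optimal functions for the part
    of [V] inside [U] and for a neighbourhood of the rest are then added up. *)
Lemma open_caratheodory (U : set T) : open U -> mu.-caratheodory U.
Proof.
move=> oU.
apply: (@le_caratheodory_measurable R T content_outer_measure) => X /=.
apply/lee_addgt0Pr => e e0.
have [V [oV XV Ve]] := content_measure_adherent X e0.
apply: le_trans Ve; apply: (@le_trans _ _ (mu (V `&` U) + mu (V `&` ~` U))).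
  by apply: leeD; apply: content_measure_mono; exact: setSI.
have oVU : open (V `&` U) by exact: openI.
rewrite (content_measure_open oVU).
rewrite -leeBrDr ?content_measure_fin//; apply: ge_ereal_sup => _ [f [cf f01 fU] <-].
rewrite leeBrDr ?content_measure_fin//.
apply/lee_addgt0Pr => d d0.
(* [f] cut at [d] and any [h] subordinate to [W] have disjoint supports, so
   their sum is subordinate to [V]. *)
pose W := V `&` [set x | (f x < d)%R].
have oW : open W by apply: openI => //; exact: open_lt_fun.
apply: (@le_trans _ _ ((Lam f)%:E + open_content W)).
  rewrite leeD2l//; apply: content_measure_le => //.
  by move=> x [Vx nU]; split => //=; rewrite fU// => -[].
rewrite addeC -leeBrDr//; apply: ge_ereal_sup => _ [h [ch h01 hW] <-].
rewrite leeBrDr// -EFinD.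
have cm : continuous (fun x => Num.max (f x - d) 0)%R.
  apply: continuous_maxf; last exact: continuous_cst_fun.
  by apply: continuous_subf => //; exact: continuous_cst_fun.
apply: (@le_trans _ _ (Lam (fun x => h x + Num.max (f x - d) 0) + d)%R%:E).
  by rewrite lee_fin LamD// -addrA lerD2l; exact: Lam_cut.
rewrite EFinD leeD2r//; apply: content_ge; split.
- exact: continuous_addf.
- move=> x; case/andP: (h01 x) => h0 h1; case/andP: (f01 x) => f0 f1.
  rewrite addr_ge0//= ?le_max ?lexx ?orbT//.
  have [fd|fd] := ltP (f x) d.
    by rewrite (max_idPr _) ?addr0// subr_le0 ltW.
  rewrite hW ?add0r; last by case=> _ /=; rewrite ltNge fd.
  by rewrite ge_max ler01 andbT lerBlDr (le_trans f1)// lerDl ltW.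
- move=> x nV; rewrite hW ?add0r; last by case.
  by rewrite fU; [rewrite sub0r; apply/max_idPr; rewrite oppr_le0 ltW|case].
Qed.

Lemma borel_caratheodory (x0 : T) (B : set (borel_at x0)) :
  measurable B -> mu.-caratheodory B.
Proof.
rewrite /measurable /=; apply: smallest_sub; last exact: open_caratheodory.
split.
- exact: (caratheodory_measurable_set0 content_outer_measure).
- move=> C mC; rewrite setTD.
  exact: (@caratheodory_measurable_setC R T content_outer_measure).
- exact: (@caratheodory_measurable_bigcup R T content_outer_measure).
Qed.

Lemma content_measure_semi_sigma_additive (x0 : T) :
  semi_sigma_additive (mu : set (borel_at x0) -> \bar R).
Proof.
move=> F mF tF mUF.
exact: (@caratheodory_measure_sigma_additive R (pointed_at x0)
  content_outer_measure F (fun i => borel_caratheodory (mF i)) tF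
  (borel_caratheodory mUF)).
Qed.

Definition content_borel_measure (x0 : T) :
    {measure set (borel_at x0) -> \bar R} :=
  HB.pack (mu : set (borel_at x0) -> \bar R)
    (isMeasure.Build _ (borel_at x0) R (mu : set (borel_at x0) -> \bar R)
      (etrans (content_measure_open open0) content_set0)
      content_measure_ge0 (@content_measure_semi_sigma_additive x0)).

Definition content_probability (x0 : T) : probability (borel_at x0) R :=
  HB.pack (mu : set (borel_at x0) -> \bar R)
    (Measure.class (content_borel_measure x0))
    (Measure_isProbability.Build _ (borel_at x0) R (content_borel_measure x0)
      (etrans (content_measure_open openT) content_setT)).

Lemma open_measurable_borel_at (x0 : T) (U : set T) :
  open U -> measurable (U : set (borel_at x0)).
Proof. by move=> oU; apply: sub_sigma_algebra. Qed.

Lemma content_probability_regular (x0 : T) :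
  regular_measure (content_probability x0).
Proof.
move=> B mB; split.
  apply/eqP; rewrite eq_le; apply/andP; split.
    apply: le_ereal_inf_tmp => _ [U [oU BU] <-].
    exact: content_measure_mono.
  apply: le_ereal_inf_tmp => _ [U [oU BU] <-].
  rewrite -content_measure_open//; apply: ereal_inf_lbound.
  by exists U.
apply/eqP; rewrite eq_le; apply/andP; split; last first.
  by apply: ge_ereal_sup => _ [K [cK KB] <-]; exact: content_measure_mono.
apply/lee_addgt0Pr => e e0.
(* Outer regularity of the complement yields inner regularity: the closed set left by [V] is compact
   and misses at most [e] of the mass of [B]. *)
have [V [oV BV Ve]] := content_measure_adherent (~` B) e0.
pose K := ~` V.
have mK : measurable (K : set (borel_at x0)).
  by apply: measurableC; exact: open_measurable_borel_at.
have KB : K `<=` B by rewrite /K -[B]setCK; exact: subsetC.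
apply: (@le_trans _ _ (content_probability x0 K + e%:E)).
  have BC := probability_setC (content_probability x0) (measurableC mB).
  have VC := probability_setC (content_probability x0)
    (@open_measurable_borel_at x0 V oV).
  rewrite setCK in BC; rewrite BC VC /= (content_measure_open oV).
  move: Ve; rewrite -(fineK (content_fin V)) -(fineK (content_measure_fin (~` B))).
  by rewrite -!EFinD !lee_fin => ?; lra.
rewrite leeD2r//; apply: ereal_sup_ubound; exists K => //; split => //.
by apply: subclosed_compact Tc _ => //; rewrite closedC.
Qed.

End Content.

(** * Unique ergodicity from averages of small oscillation *)

Section ActionAverages.
Context {R : realType} {T : topologicalType} (act : R -> T -> T).
Implicit Types (F G : T -> R) (ts us : seq R).

Definition act_avg ts F (x : T) : R :=
  (\sum_(t <- ts) F (act t x)) / (size ts)%:R.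

Lemma act_avg_cst ts (c : R) x : (0 < size ts)%N -> act_avg ts (fun=> c) x = c.
Proof.
move=> ts0; rewrite /act_avg big_const_seq count_predT iter_addr_0 -[c *+ _]mulr_natr.
by rewrite mulfK// pnatr_eq0 -lt0n.
Qed.

Lemma act_avgD ts F G x :
  act_avg ts (fun y => F y + G y) x = act_avg ts F x + act_avg ts G x.
Proof. by rewrite /act_avg big_split mulrDl. Qed.

Lemma ler_act_avg ts F G x : (forall y, F y <= G y) ->
  act_avg ts F x <= act_avg ts G x.
Proof.
by move=> FG; rewrite /act_avg ler_wpM2r ?invr_ge0 ?ler0n// ler_sum.
Qed.

Hypothesis actD : forall s t x, act s (act t x) = act (s + t) x.

Lemma act_avg_act ts F t x : act_avg ts (F \o act t) x = act_avg ts F (act t x).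
Proof.
rewrite /act_avg; congr (_ / _); apply: eq_bigr => s _ /=.
by rewrite !actD addrC.
Qed.

Lemma act_avg_allpairs ts us F x :
  act_avg [seq t + u | t <- ts, u <- us] F x = act_avg ts (act_avg us F) x.
Proof.
rewrite /act_avg size_allpairs natrM big_allpairs_dep /= -mulr_suml invfM.
rewrite [(size ts)%:R^-1 * _]mulrC mulrA; congr (_ / _ / _).
by apply: eq_bigr => t _; apply: eq_bigr => u _; rewrite actD addrC.
Qed.

Lemma act_avgC ts us F x :
  act_avg ts (act_avg us F) x = act_avg us (act_avg ts F) x.
Proof.
rewrite /act_avg -!mulr_suml exchange_big /= mulrAC; congr (_ / _ / _).
by apply: eq_bigr => t _; apply: eq_bigr => u _; rewrite !actD addrC.
Qed.

Hypothesis cact : forall t, continuous (act t).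
Hypothesis small_osc : forall F, continuous F -> forall e : R, 0 < e ->
  exists2 ts, (0 < size ts)%N &
    forall x y, act_avg ts F x - act_avg ts F y <= e.
Variable x0 : T.

(** Every uniform lower bound of one average lies below every uniform upper bound of any other
    ([act_avg_bound_le]), so a nearly constant average pins this supremum from both sides. *)
Definition act_mean F : R :=
  sup [set v | exists2 ts, (0 < size ts)%N & forall x, v <= act_avg ts F x].

(** The iterated average over both lists at [x0] lies above [v] in one order and below [w] in the
    other, and the two orders agree. *)
Lemma act_avg_bound_le ts us F (v w : R) : (0 < size ts)%N -> (0 < size us)%N ->
  (forall x, v <= act_avg ts F x) -> (forall x, act_avg us F x <= w) -> v <= w.
Proof.
move=> ts0 us0 Hv Hw.
rewrite -(act_avg_cst v x0 us0) -(act_avg_cst w x0 ts0).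
apply: le_trans (ler_act_avg ts x0 Hw); rewrite act_avgC.
exact: ler_act_avg.
Qed.

Lemma act_mean_ge ts F (v : R) : continuous F -> (0 < size ts)%N ->
  (forall x, v <= act_avg ts F x) -> v <= act_mean F.
Proof.
move=> cF ts0 Hv; apply: ub_le_sup; last by exists ts.
have [us us0 osc] := small_osc cF ltr01.
exists (1 + act_avg us F x0) => w [rs rs0 Hw].
apply: (act_avg_bound_le rs0 us0 Hw) => x.
by rewrite -lerBlDr; exact: osc.
Qed.

Lemma act_mean_le ts F (w : R) : continuous F -> (0 < size ts)%N ->
  (forall x, act_avg ts F x <= w) -> act_mean F <= w.
Proof.
move=> cF ts0 Hw; apply: ge_sup.
  have [us us0 osc] := small_osc cF ltr01.
  exists (act_avg us F x0 - 1), us => // x.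
  by rewrite lerBlDr addrC -lerBlDr; exact: osc.
by move=> v [us us0 Hv]; exact: (act_avg_bound_le us0 ts0 Hv).
Qed.

Lemma act_mean_approx F (e : R) : continuous F -> 0 < e ->
  exists2 ts, (0 < size ts)%N & forall x, `|act_avg ts F x - act_mean F| <= e.
Proof.
move=> cF e0; have [ts ts0 osc] := small_osc cF e0.
exists ts => // x; rewrite ler_norml; apply/andP; split.
  rewrite lerBrDr addrC -lerBrDr opprK; apply: (act_mean_le cF ts0) => y.
  by rewrite -lerBlDl; exact: osc.
rewrite lerBlDr -lerBlDl; apply: (act_mean_ge cF ts0) => y.
by rewrite lerBlDr -lerBlDl; exact: osc.
Qed.

Lemma act_mean_cst (c : R) : act_mean (fun=> c) = c.
Proof.
have cc := @continuous_cst_fun R T c.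
apply/eqP; rewrite eq_le; apply/andP; split.
  by apply: (act_mean_le (ts := [:: 0])) => // x; rewrite act_avg_cst.
by apply: (act_mean_ge (ts := [:: 0])) => // x; rewrite act_avg_cst.
Qed.

Lemma ler_act_mean F G : continuous F -> continuous G ->
  (forall x, F x <= G x) -> act_mean F <= act_mean G.
Proof.
move=> cF cG FG; apply/ler_addgt0Pr => e e0.
have [ts ts0 Hts] := act_mean_approx cG e0.
apply: (act_mean_le cF ts0) => x; apply: le_trans (ler_act_avg ts x FG) _.
by rewrite -lerBlDl; have := Hts x; rewrite ler_norml => /andP[].
Qed.

Lemma act_meanD F G : continuous F -> continuous G ->
  act_mean (fun x => F x + G x) = act_mean F + act_mean G.
Proof.
move=> cF cG; have cFG := continuous_addf cF cG.
have H e : 0 < e -> exists2 ts, (0 < size ts)%N & forall x,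
    `|act_avg ts (fun x => F x + G x) x - (act_mean F + act_mean G)| <= e.
  move=> e0; have e20 : 0 < e / 2 by rewrite divr_gt0.
  have [ts ts0 Hts] := act_mean_approx cF e20.
  have [us us0 Hus] := act_mean_approx cG e20.
  (* The sumset serves [F] and [G] at once: its average is an average of [ts]-averages and equally
     of [us]-averages, so both bounds survive. *)
  exists [seq t + u | t <- ts, u <- us]; first by rewrite size_allpairs muln_gt0 ts0.
  move=> x; rewrite act_avgD !act_avg_allpairs (act_avgC ts us F) opprD addrACA.
  rewrite (splitr e); apply: (le_trans (ler_normD _ _)); apply: lerD.
    rewrite ler_norml; apply/andP; split.
      rewrite lerBrDr addrC; rewrite -[X in X <= _](act_avg_cst _ x us0).
      apply: ler_act_avg => y; have := Hts y; rewrite ler_norml => /andP[+ _].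
      by rewrite lerBrDr addrC.
    rewrite lerBlDr -[X in _ <= X](act_avg_cst _ x us0).
    apply: ler_act_avg => y; have := Hts y; rewrite ler_norml => /andP[_].
    by rewrite lerBlDr.
  rewrite ler_norml; apply/andP; split.
    rewrite lerBrDr addrC; rewrite -[X in X <= _](act_avg_cst _ x ts0).
    apply: ler_act_avg => y; have := Hus y; rewrite ler_norml => /andP[+ _].
    by rewrite lerBrDr addrC.
  rewrite lerBlDr -[X in _ <= X](act_avg_cst _ x ts0).
  apply: ler_act_avg => y; have := Hus y; rewrite ler_norml => /andP[_].
  by rewrite lerBlDr.
apply/eqP; rewrite eq_le; apply/andP; split; apply/ler_addgt0Pr => e /H[ts ts0 Hts].
  apply: (act_mean_le cFG ts0) => x; rewrite -lerBlDl.
  by have := Hts x; rewrite ler_norml => /andP[].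
rewrite -lerBlDr; apply: (act_mean_ge cFG ts0) => x.
by have := Hts x; rewrite ler_norml lerBrDr addrC => /andP[].
Qed.

Lemma act_mean_act F t : continuous F -> act_mean (F \o act t) = act_mean F.
Proof.
move=> cF; have cFt : continuous (F \o act t).
  by move=> x; apply: continuous_comp; [exact: cact|exact: cF].
apply/eqP; rewrite eq_le; apply/andP; split; apply/ler_addgt0Pr => e e0;
  have [ts ts0 Hts] := act_mean_approx cF e0.
  apply: (act_mean_le cFt ts0) => x; rewrite act_avg_act -lerBlDl.
  by have := Hts (act t x); rewrite ler_norml => /andP[].
rewrite -lerBlDr; apply: (act_mean_ge cFt ts0) => x; rewrite act_avg_act.
by have := Hts (act t x); rewrite ler_norml lerBrDr addrC => /andP[].
Qed.

End ActionAverages.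

(** * Invariance and uniqueness of the measure of the mean *)

Section UniqueErgodicity.
Context {R : realType} {T : topologicalType} (act : R -> T -> T).
Hypothesis Tc : compact [set: T].
Hypothesis Th : hausdorff_space T.
Hypothesis act0 : forall x, act 0 x = x.
Hypothesis actD : forall s t x, act s (act t x) = act (s + t) x.
Hypothesis cact : forall t, continuous (act t).
Hypothesis small_osc : forall F : T -> R, continuous F ->
  forall e : R, 0 < e -> exists2 ts, (0 < size ts)%N &
    forall x y, act_avg act ts F x - act_avg act ts F y <= e.
Variable x0 : T.

Local Notation mean := (act_mean act).
Let LamD := act_meanD actD small_osc x0.
Let Lam_le := ler_act_mean actD small_osc x0.
Let Lam_cst := act_mean_cst actD small_osc x0.

Let actN t x : act t (act (- t) x) = x.
Proof. by rewrite actD subrr act0. Qed.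

Lemma content_act_le t (U : set T) :
  (open_content mean U <= open_content mean (act t @^-1` U))%E.
Proof.
apply: ge_ereal_sup => _ [f [cf f01 fU] <-].
rewrite -(act_mean_act actD cact small_osc x0 t cf); apply: content_ge.
split => [x|x|x] /=; first by apply: continuous_comp; [exact: cact|exact: cf].
  exact: f01.
exact: fU.
Qed.

Lemma preimage_actN t (B : set T) : act (- t) @^-1` (act t @^-1` B) = B.
Proof. by apply/seteqP; split => x /=; rewrite actN. Qed.

Lemma content_act t (U : set T) : open_content mean (act t @^-1` U) = open_content mean U.
Proof.
apply/eqP; rewrite eq_le content_act_le andbT.
by rewrite -{2}(preimage_actN t U); exact: content_act_le.
Qed.

Lemma open_act_preimage t (U : set T) : open U -> open (act t @^-1` U).
Proof. by move=> oU; apply: open_comp => // x _; exact: cact. Qed.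

Lemma content_measure_act_le t (B : set T) :
  (content_measure mean (act t @^-1` B) <= content_measure mean B)%E.
Proof.
apply: le_ereal_inf_tmp => _ [U [oU BU] <-].
rewrite -(content_act t U); apply: content_measure_le.
  exact: open_act_preimage.
by move=> x /= /BU.
Qed.

Lemma content_measure_act t (B : set T) :
  content_measure mean (act t @^-1` B) = content_measure mean B.
Proof.
apply/eqP; rewrite eq_le content_measure_act_le /=.
by rewrite -{1}(preimage_actN t B); exact: content_measure_act_le.
Qed.

Section Uniqueness.
Variable nu : probability (borel_at x0) R.
Hypothesis nu_inv : invariant_measure act nu.

(** By invariance each time in [ts] contributes [nu B]; integrating a pointwise bound on visit
    frequencies therefore bounds [nu B]. *)
Lemma integral_visits ts (B : set (borel_at x0)) :
  (forall t, measurable (act t @^-1` B : set (borel_at x0))) ->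
  measurable B ->
  (\int[nu]_x (\sum_(t <- ts) (\1_B (act t x))%:E) =
    (size ts)%:R%:E * nu B)%E.
Proof.
move=> mt mB; rewrite ge0_integral_sum//=.
- rewrite (eq_bigr (fun=> nu B)) => [|t _].
    by rewrite big_const_seq count_predT iter_addr_0 mule_natl.
  rewrite -(nu_inv t mB) -[X in nu X]setIT -integral_indic//.
- move=> t; apply/measurable_EFinP.
  exact: (measurable_indic (mt t)).
Qed.

Lemma prob_integral_cst (c : \bar R) : (\int[nu]_x (cst c x) = c)%E.
Proof.
rewrite integral_cst// [X in (_ * X)%E](_ : _ = 1%E) ?mule1//.
exact: (probability_setT nu).
Qed.

Lemma prob_visits_le ts (B : set (borel_at x0)) (w : R) :
  (forall t, measurable (act t @^-1` B : set (borel_at x0))) ->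
  measurable B -> (0 < size ts)%N ->
  (forall x, act_avg act ts \1_B x <= w) -> (nu B <= w%:E)%E.
Proof.
move=> mt mB ts0 Hw.
have n0 : (0 < (size ts)%:R :> R) by rewrite ltr0n.
suff : ((size ts)%:R%:E * nu B <= (size ts)%:R%:E * w%:E)%E.
  by rewrite lee_pmul2l ?lte_fin.
rewrite -(integral_visits ts mt mB).
apply: (@le_trans _ _ (\int[nu]_x (cst ((size ts)%:R%:E * w%:E)%E x))%E).
  apply: ge0_le_integral => //=.
  - by move=> x _; apply: sume_ge0 => t _; rewrite lee_fin.
  - apply: emeasurable_sum => t; apply/measurable_EFinP.
    exact: (measurable_indic (mt t)).
  - move=> x _; rewrite sumEFin -EFinM lee_fin.
    rewrite mulrC -ler_pdivrMr//; exact: Hw.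
by rewrite prob_integral_cst.
Qed.

Lemma prob_visits_ge ts (B : set (borel_at x0)) (v : R) :
  (forall t, measurable (act t @^-1` B : set (borel_at x0))) ->
  measurable B -> (0 < size ts)%N -> 0 <= v ->
  (forall x, v <= act_avg act ts \1_B x) -> (v%:E <= nu B)%E.
Proof.
move=> mt mB ts0 v0 Hv.
have n0 : (0 < (size ts)%:R :> R) by rewrite ltr0n.
suff : ((size ts)%:R%:E * v%:E <= (size ts)%:R%:E * nu B)%E.
  by rewrite lee_pmul2l ?lte_fin.
rewrite -(integral_visits ts mt mB).
apply: (@le_trans _ _ (\int[nu]_x (cst ((size ts)%:R%:E * v%:E)%E x))%E).
  by rewrite prob_integral_cst.
apply: ge0_le_integral => //=.
- by move=> x _; rewrite -EFinM lee_fin mulr_ge0.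
- apply: emeasurable_sum => t; apply/measurable_EFinP.
  exact: (measurable_indic (mt t)).
- move=> x _; rewrite sumEFin -EFinM lee_fin.
  by rewrite mulrC -ler_pdivlMr//; exact: Hv.
Qed.

Hypothesis nu_reg : regular_measure nu.

(** Some average of a continuous [f] is within [e] of [mean f] at all points, so visit frequencies
    compare with it. Inner regularity and a bump above a compact set give the upper bound, functions
    below the indicator of [U] the lower one. *)
Lemma invariant_content (U : set T) : open U -> nu U = open_content mean U.
Proof.
move=> oU; apply/eqP; rewrite eq_le; apply/andP; split.
  have [_ ->] := nu_reg (open_measurable_borel_at oU).
  apply: ge_ereal_sup => _ [K [cK KU] <-].
  have cloK : closed K by exact: compact_closed.
  have [f [cf f01 fK fU]] := @compact_hausdorff_bump R T _ _ Tc Th cloK oU KU.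
  apply: (@le_trans _ _ (mean f)%:E); last by apply: content_ge.
  apply/lee_addgt0Pr => e e0; rewrite -EFinD.
  have [ts ts0 Hts] := act_mean_approx actD small_osc x0 cf e0.
  have mK (C : set T) : closed C -> measurable (C : set (borel_at x0)).
    by move=> cC; rewrite -[C]setCK; apply: measurableC;
      apply: open_measurable_borel_at; rewrite openC.
  apply: (@prob_visits_le ts) => //; last 2 first.
  - exact: mK.
  - move=> x; apply: le_trans (_ : act_avg act ts f x <= _).
      apply: ler_act_avg => y; rewrite indicE.
      case: (boolP (y \in K)) => [/set_mem/fK->//|_].
      by case/andP: (f01 y).
    by rewrite -lerBlDl; have := Hts x; rewrite ler_norml => /andP[].
  move=> t; apply: mK; apply: preimage_closed => // x; exact: cact.
apply: ge_ereal_sup => _ [f [cf f01 fU] <-].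
apply/lee_addgt0Pr => e e0; rewrite -leeBlDr// -EFinB.
(* A negative bound is trivial; [prob_visits_ge] compares integrals of nonnegative functions. *)
have [e1|e1] := leP 0 (mean f - e); last first.
  by rewrite (@le_trans _ _ 0%E)// lee_fin ltW.
have [ts ts0 Hts] := act_mean_approx actD small_osc x0 cf e0.
apply: (@prob_visits_ge ts) => //.
- by move=> t; apply: open_measurable_borel_at; exact: open_act_preimage.
- exact: open_measurable_borel_at.
- move=> x; apply: (@le_trans _ _ (act_avg act ts f x)).
    by have := Hts x; rewrite ler_norml lerBrDr addrC => /andP[].
  apply: ler_act_avg => y; rewrite indicE.
  case: (boolP (y \in U)) => [_|]; first by case/andP: (f01 y).
  by move=> /negP yU; rewrite fU// => Uy; apply: yU; exact: mem_set.
Qed.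

End Uniqueness.

Lemma uniquely_ergodic_of_averages : uniquely_ergodic act.
Proof.
exists x0, (content_probability Tc Th LamD Lam_le Lam_cst x0); split.
- exact: content_probability_regular.
- by move=> t B mB; exact: content_measure_act.
- move=> nu nu_reg nu_inv B mB; have [-> _] := nu_reg B mB.
  rewrite /= /content_measure; congr ereal_inf.
  by apply: eq_imagel => U [oU _]; exact: invariant_content.
Qed.

End UniqueErgodicity.

(** * Iterated columns and their means *)

Section Columns.
Context {A : topologicalType} (rho : A -> nonempty_word A).
Variable L : nat.
Hypothesis rho_length : constant_length rho L.

(* For [j < L ^ p], [iter_column p j a] is the [j]-th letter of [rho^p(a)]. *)
Fixpoint iter_column (p j : nat) : A -> A :=
  if p is q.+1 then column rho (j %% L) \o iter_column q (j %/ L) else id.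

Lemma constant_length_gt0 (a : A) : (0 < L)%N.
Proof. by rewrite -(rho_length a) /subst_letter size_map size_enum_ord. Qed.

Lemma subst_letterE a :
  subst_letter rho a = [seq column rho j a | j <- iota 0 L].
Proof.
rewrite -(rho_length a) -[LHS](mkseq_nth a) /mkseq.
by apply: eq_map => j; rewrite /column.
Qed.

Lemma subst_seq_cat s t :
  subst_seq rho (s ++ t) = subst_seq rho s ++ subst_seq rho t.
Proof. by rewrite /subst_seq map_cat flatten_cat. Qed.

Lemma iter_subst_seq_cat p s t :
  iter p (subst_seq rho) (s ++ t) =
  iter p (subst_seq rho) s ++ iter p (subst_seq rho) t.
Proof. by elim: p => //= p ->; rewrite subst_seq_cat. Qed.

Lemma size_subst_seq s : size (subst_seq rho s) = (size s * L)%N.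
Proof.
elim: s => //= a s ih.
by rewrite /subst_seq /= size_cat -/(subst_seq rho s) ih rho_length mulSn.
Qed.

Lemma size_iter_subst_seq p s :
  size (iter p (subst_seq rho) s) = (size s * L ^ p)%N.
Proof.
elim: p => [|p ih] /=; first by rewrite expn0 muln1.
by rewrite size_subst_seq ih expnSr mulnA.
Qed.

Lemma size_subst_iter p a : size (subst_iter rho p a) = (L ^ p)%N.
Proof. by rewrite /subst_iter size_iter_subst_seq mul1n. Qed.

Lemma nth_subst_seq (b : A) s j : (j < size s * L)%N ->
  nth b (subst_seq rho s) j = column rho (j %% L) (nth b s (j %/ L)).
Proof.
elim: s j => [|a s ih] j //=; rewrite mulSn => jL.
rewrite /subst_seq /= nth_cat rho_length -/(subst_seq rho s).
have L0 := constant_length_gt0 a.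
case: ltnP => jl.
  rewrite modn_small// divn_small//= /column; apply: set_nth_default.
  by rewrite rho_length.
have -> : j = (L + (j - L))%N by rewrite subnKC.
rewrite addKn modnDl divnDl ?dvdnn// divnn L0 add1n /=.
by rewrite ih// ltn_subLR.
Qed.

(** The quotient by [L ^ p] names the letter of [s] whose block contains position [j]; the base [L]
    digits of the remainder select the columns to apply. *)
Lemma nth_iter_subst_seq (b : A) p s j : (j < size s * L ^ p)%N ->
  nth b (iter p (subst_seq rho) s) j =
  iter_column p (j %% L ^ p) (nth b s (j %/ L ^ p)).
Proof.
elim: p j => [|p ih] j js /=; first by rewrite expn0 divn1.
have L0 := constant_length_gt0 b.
rewrite nth_subst_seq ?size_iter_subst_seq -?mulnA -?expnSr//.
rewrite ih; last by rewrite ltn_divLR// -mulnA -expnSr.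
rewrite -divnMA -expnS; congr (column _ _ (iter_column _ _ _)).
  by rewrite modn_dvdm// expnS dvdn_mulr.
by rewrite expnSr modn_divl.
Qed.

Lemma nth_subst_iter (b : A) p a j : (j < L ^ p)%N ->
  nth b (subst_iter rho p a) j = iter_column p j a.
Proof.
by move=> jp; rewrite /subst_iter nth_iter_subst_seq ?mul1n// modn_small// divn_small.
Qed.

Lemma subst_iterE p a :
  subst_iter rho p a = [seq iter_column p j a | j <- iota 0 (L ^ p)].
Proof.
apply: (@eq_from_nth _ a); first by rewrite size_subst_iter size_map size_iota.
move=> j; rewrite size_subst_iter => jp.
by rewrite nth_subst_iter// (nth_map 0%N) ?size_iota// nth_iota.
Qed.

Lemma subst_iterD p q a :
  subst_iter rho (p + q) a = iter p (subst_seq rho) (subst_iter rho q a).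
Proof. by rewrite /subst_iter iterD. Qed.

Lemma iter_columnD p q j a : (j < L ^ (p + q))%N ->
  iter_column (p + q) j a =
  iter_column p (j %% L ^ p) (iter_column q (j %/ L ^ p) a).
Proof.
move=> jpq; have L0 := constant_length_gt0 a.
rewrite -(nth_subst_iter a a jpq) subst_iterD nth_iter_subst_seq.
  by rewrite nth_subst_iter// ltn_divLR ?expn_gt0 ?L0// -expnD addnC.
by rewrite size_subst_iter mulnC -expnD.
Qed.

(** For [p = 0] the map is the identity, which the semigroup may fail to contain. *)
Lemma iter_column_semigroup p j (a : A) : (0 < p)%N ->
  column_semigroup rho L (iter_column p j).
Proof.
have L0 := constant_length_gt0 a.
have C i : column_semigroup rho L (column rho (i %% L)).
  exact: (column_semigroup_gen rho (Ordinal (ltn_pmod i L0))).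
elim: p j => // -[|p] ih j _ /=; first exact: C.
by apply: column_semigroup_comp; [exact: C|exact: ih].
Qed.

Lemma continuous_column j : continuous rho -> (j < L)%N ->
  continuous (column rho j).
Proof.
move=> crho jL a.
(* On each summand [g] is a coordinate projection, hence continuous; on the values of [rho], all of
   length [L], that coordinate is the letter [j]. *)
pose g (n : nat) (u : {ptws 'I_n.+1 -> A}) : A := u (inord j).
have cg : continuous (fun w : nonempty_word A => g (projT1 w) (projT2 w)).
  apply: sigT_continuous => n.
  exact: (@proj_continuous 'I_n.+1 (fun=> A) (inord j)).
have -> : column rho j = (fun w : nonempty_word A => g (projT1 w) (projT2 w)) \o rho.
  apply/funext => b; rewrite /column /subst_letter /= /g.
  have := rho_length b; rewrite /subst_letter size_map size_enum_ord => nL.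
  have jn : (j < (projT1 (rho b)).+1)%N by rewrite nL.
  rewrite (nth_map (inord j)) ?size_enum_ord//; congr (projT2 (rho b) _).
  by apply: val_inj; rewrite /= nth_enum_ord// inordK.
by apply: continuous_comp; [exact: crho|exact: cg].
Qed.

Lemma continuous_iter_column p j : continuous rho ->
  continuous (iter_column p j).
Proof.
move=> crho; elim: p j => [|p ih] j a /=; first exact: cvg_id.
apply: continuous_comp; first exact: ih.
by apply: continuous_column => //; rewrite ltn_pmod// (constant_length_gt0 a).
Qed.

Lemma subst_opE {V : nmodType} (f : A -> V) a :
  subst_op rho f a = \sum_(j < L) f (column rho j a).
Proof.
by rewrite /subst_op subst_letterE big_map -{1}[L]subn0 big_mkord.
Qed.

Lemma iter_subst_op {V : nmodType} (f : A -> V) p a :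
  iter p (subst_op rho) f a = \sum_(j < L ^ p) f (iter_column p j a).
Proof.
suff -> : iter p (subst_op rho) f a = \sum_(b <- subst_iter rho p a) f b.
  by rewrite subst_iterE big_map -{1}[(L ^ p)%N]subn0 big_mkord.
elim: p a => [|p ih] a; first by rewrite /= big_seq1.
rewrite iterS /subst_op -addn1 subst_iterD /subst_iter /=.
under eq_bigr do rewrite ih.
rewrite /subst_seq /= cats0; elim: (subst_letter rho a) => [|b s IH].
  by rewrite big_nil (_ : iter _ _ _ = [::]) ?big_nil//; elim: p {ih} => //= p ->.
rewrite big_cons IH -cat1s iter_subst_seq_cat big_cat.
by congr (_ + _).
Qed.

End Columns.

(** * Uniform continuity on a compact space *)

Section UniformSpaces.
Context {R : realType} {A : uniformType}.
Hypothesis A_compact : compact [set: A].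

(** Heine-Cantor: the covering form of compactness is applied along the filter of small entourages.
    Properness of the entourage filter asks for a point of [A], whence the case split. *)
Lemma compact_unif_continuous (h : A -> R) (e : R) : continuous h -> 0 < e ->
  exists2 E : set (A * A), entourage E &
    forall x y, E (x, y) -> `|h x - h y| <= e.
Proof.
move=> ch e0; have e20 : 0 < e / 2 by rewrite divr_gt0.
pose P (E : set (A * A)) x := forall y, E (x, y) -> `|h x - h y| <= e.
have [[a _]|nA] := pselect (exists a : A, True); last first.
  by exists setT => [|x]; [exact: entourageT|case: nA; exists x].
have PF : ProperFilter (@entourage A).
  by split; [by move=> /(@entourage_refl _ _ a)|exact: entourage_filter].
have /compact_near_coveringP cov := A_compact.
have : \forall E \near powerset_filter_from entourage, [set: A] `<=` P E.
  apply: cov => x0 _.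
  have := ch x0; move/cvgrPdist_lt => /(_ _ e20) /nbhsP[E0 entE0 E0h].
  have [E1 entE1 E11] := entourage_split_ex entE0.
  exists (xsection E1 x0, [set E | E `<=` E1]).
    split => /=; first exact: nbhs_entourage.
    apply/near_powerset_filter_fromP; last by exists E1.
    by move=> E2 E3 E23 /(subset_trans E23).
  move=> [x E] [/= /xsectionP E1x EE1] y /EE1 E1xy.
  have hx : `|h x0 - h x| < e / 2.
    apply: E0h; apply/xsectionP; apply: E11; exists x => //; exact: entourage_refl.
  have hy : `|h x0 - h y| < e / 2.
    by apply: E0h; apply/xsectionP; apply: E11; exists x.
  rewrite (splitr e); have -> : h x - h y = (h x0 - h y) - (h x0 - h x) by ring.
  by apply: le_trans (ler_normB _ _) _; rewrite addrC lerD// ltW.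
move=> /near_powerset_filter_fromP[|E entE PE].
  by move=> E2 E3 E23 P3 x _ y /E23; exact: P3.
by exists E => // x y; exact: PE.
Qed.

End UniformSpaces.

(** * Convergence of the iterates of [T], and natural length functions *)

Section IteratedMeans.
Context {R : realType} {A : uniformType}.
Hypothesis A_compact : compact [set: A].
Variable rho : A -> nonempty_word A.
Hypothesis rho_continuous : continuous rho.
Hypothesis rho_primitive : primitive rho.
Variable L : nat.
Hypothesis rho_length : constant_length rho L.
Hypothesis rho_equicontinuous :
  uniformly_equicontinuous (column_semigroup rho L).
Implicit Types h : A -> R.

Local Notation col := (iter_column rho L).

Definition iter_mean n h a : R := (\sum_(j < L ^ n) h (col n j a)) / (L ^ n)%:R.

Let Ln_gt0 (a : A) n : 0 < (L ^ n)%:R :> R.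
Proof. by rewrite ltr0n expn_gt0 (constant_length_gt0 rho_length a). Qed.

Lemma iter_mean_subst_op n h a :
  iter_mean n h a = iter n (subst_op rho) h a / (L ^ n)%:R.
Proof. by rewrite (iter_subst_op rho_length). Qed.

Lemma iter_meanD p q h a : iter_mean (q + p) h a = iter_mean q (iter_mean p h) a.
Proof.
rewrite [RHS]/iter_mean iter_mean_subst_op iterD (iter_subst_op rho_length).
under [in RHS]eq_bigr do rewrite iter_mean_subst_op.
by rewrite -mulr_suml expnD natrM invfM -mulrA [X in _ * X]mulrC.
Qed.

Lemma iter_mean_le n h (c : R) a : (forall x, h x <= c) -> iter_mean n h a <= c.
Proof.
move=> hc; rewrite /iter_mean ler_pdivrMr ?(Ln_gt0 a)//.
apply: le_trans (ler_sum _ (fun j _ => hc _)) _.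
by rewrite sumr_const card_ord mulr_natr.
Qed.

Lemma iter_mean_ge n h (c : R) a : (forall x, c <= h x) -> c <= iter_mean n h a.
Proof.
move=> hc; rewrite /iter_mean ler_pdivlMr ?(Ln_gt0 a)//.
apply: le_trans (ler_sum _ (fun j _ => hc _)).
by rewrite sumr_const card_ord mulr_natr.
Qed.

Lemma iter_mean_dist n h x y (e : R) :
  (forall j, `|h (col n j x) - h (col n j y)| <= e) ->
  `|iter_mean n h x - iter_mean n h y| <= e.
Proof.
move=> he; rewrite /iter_mean -mulrBl -sumrB normrM normfV.
rewrite (gtr0_norm (Ln_gt0 x n)) ler_pdivrMr ?(Ln_gt0 x)//.
apply: le_trans (ler_norm_sum _ _ _) _.
apply: le_trans (ler_sum _ (fun j _ => he _)) _.
by rewrite sumr_const card_ord mulr_natr.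
Qed.

(** Primitivity gives an exponent for each neighbourhood separately. Finitely many neighbourhoods
    suffice by compactness, and every larger exponent also works, so one [P] serves all [y]. *)
Lemma primitive_hits (D : set (A * A)) : entourage D ->
  exists P, forall y a, exists2 j, (j < L ^ P)%N & D (y, col P j a).
Proof.
move=> entD.
pose Q P y := forall a, exists2 j, (j < L ^ P)%N & D (y, col P j a).
have /compact_near_coveringP cov := A_compact.
have : \forall P \near \oo, [set: A] `<=` Q P; last first.
  by move=> /filter_ex[P QP]; exists P => y; exact: QP.
apply: cov => y0 _.
have [E entE EE] := entourage_split_ex entD.
pose E' := E `&` E^-1%relation.
have entE' : entourage E' by apply: filterI => //; exact: entourage_inv.
pose U := (xsection E' y0)^°.
have oU : open U by exact: open_interior.
have Uy0 : U y0 by exact: nbhs_entourage.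
have [p Hp] := rho_primitive oU (ex_intro _ y0 Uy0).
exists (xsection E' y0, [set n | (p <= n)%N]).
  by split => /=; [exact: nbhs_entourage|exact: nbhs_infty_ge].
move=> [y n] [/= /xsectionP[_ Ey] pn] a.
(* To pass from [p] to [n >= p], use primitivity below the first letter of [rho^(n-p)(a)]; its block
   occupies the indices [j < L ^ p]. *)
have [b bp /interior_subset/xsectionP[Eb _]] := Hp (col (n - p) 0 a).
move: bp; rewrite (subst_iterE rho_length) => /mapP[j].
rewrite mem_iota add0n => /= jp bE.
have L0 := constant_length_gt0 rho_length a.
have jn : (j < L ^ n)%N by apply: leq_trans jp _; rewrite leq_pexp2l.
exists j => //; apply: EE; exists y0; first exact: Ey.
rewrite -(subnKC pn) (iter_columnD rho_length) ?subnKC//.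
by rewrite modn_small// divn_small// -bE.
Qed.

Lemma equicontinuous_iter_column (E : set (A * A)) : entourage E ->
  exists2 D : set (A * A), entourage D &
    forall x y, D (x, y) -> forall n j, E (col n j x, col n j y).
Proof.
move=> entE; have [D entD DE] := rho_equicontinuous entE.
(* The factor [E] takes care of [n = 0], where the iterated column is the identity. *)
exists (D `&` E); first exact: filterI.
move=> x y [Dxy Exy] [|n] j //; apply: DE => //.
exact: (iter_column_semigroup rho_length _ x).
Qed.

Lemma iter_mean_osc_mono n m h (e : R) : (n <= m)%N ->
  (forall x y, iter_mean n h x - iter_mean n h y <= e) ->
  forall x y, iter_mean m h x - iter_mean m h y <= e.
Proof.
move=> nm He x y; rewrite -(subnK nm) !iter_meanD lerBlDr.
apply: iter_mean_le => z; rewrite -lerBlDl; apply: iter_mean_ge => t.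
by rewrite lerBlDl -lerBlDr.
Qed.

Lemma iter_mean_small_osc h (e : R) : continuous h -> 0 < e ->
  exists n, forall x y, iter_mean n h x - iter_mean n h y <= e.
Proof.
move=> ch e_gt0; pose d := e / 4; have d0 : 0 < d by rewrite divr_gt0.
have [E entE Eh] := compact_unif_continuous A_compact ch d0.
have [D entD DE] := equicontinuous_iter_column entE.
have [C C0 hC] := compact_bounded_fun A_compact ch.
have [P hitP] := primitive_hits entD.
have [a0|nA] := pselect (exists a : A, True); last first.
  by exists 0%N => x; case: nA; exists x.
case: a0 => a0 _.
pose K : R := (L ^ P)%:R; have K0 : 0 < K by exact: Ln_gt0.
(* A low value at [y] is seen, up to [2 * d], among the [K] letters below any
   [a], so each [P] further steps lower the upper bound by [d / K]. *)
have step k : (exists n, forall x y, iter_mean n h x - iter_mean n h y <= e) \/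
    forall a, iter_mean (k * P) h a <= C - k%:R * (d / K).
  elim: k => [|k [ih|ih]]; [right|by left|].
    by move=> a; rewrite mul0n mul0r subr0; apply: iter_mean_le => x;
      rewrite (le_trans (ler_norm _)).
  have [osc|] := pselect (forall x y, iter_mean (k * P) h x - iter_mean (k * P) h y <= e).
    by left; exists (k * P)%N.
  move=> /existsNP[x /existsNP[y /negP]]; rewrite -ltNge => gxy.
  right => a; rewrite mulSn iter_meanD.
  set g := iter_mean (k * P) h in ih gxy *; set B := C - _ in ih.
  have [j jP Dj] := hitP y a.
  rewrite /iter_mean ler_pdivrMr// (bigD1 (Ordinal jP))//=.
  have gj : g (col P j a) <= B - d.
    have : `|g y - g (col P j a)| <= d.
      by apply: iter_mean_dist => i; apply: Eh; exact: DE.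
    rewrite ler_norml => /andP[+ _]; rewrite lerBrDr addrC lerBlDr => gj.
    apply: le_trans gj _; have := ih x; have : e = 4 * d by rewrite /d; field.
    by move: gxy d0; lra.
  have rest : \sum_(i < L ^ P | i != Ordinal jP) g (col P i a) <= B * (K - 1).
    apply: le_trans (ler_sum _ (fun i _ => ih _)) _.
    rewrite sumr_const cardC1 card_ord -mulr_natr -subn1 natrB//.
    by rewrite expn_gt0 (constant_length_gt0 rho_length a).
  apply: le_trans (lerD gj rest) _; rewrite -/K.
  have -> : (C - k.+1%:R * (d / K)) * K = B * K - d.
    by rewrite /B -natr1; field; rewrite gt_eqF.
  by rewrite le_eqVlt; apply/orP; left; apply/eqP; ring.
(* After this many drops the upper bound would lie below [- C], so the first alternative of [step]
   must hold. *)
have [k Hk] : exists k : nat, 2 * C < k%:R * (d / K).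
  exists (Num.bound (2 * C / (d / K))).
  rewrite -ltr_pdivrMr ?divr_gt0// archi_boundP// divr_ge0 ?mulr_ge0//.
  - exact: ltW.
  - exact: ltW.
  - by rewrite invr_ge0 ltW.
case: (step k) => // /(_ a0); have : - C <= iter_mean (k * P) h a0.
  by apply: iter_mean_ge => x; have := hC x; rewrite ler_norml => /andP[].
by move: Hk; lra.
Qed.

(** Further means preserve uniform lower and upper bounds. Hence the supremum of all uniform lower
    bounds stays within the oscillation of every late mean. *)
Lemma iter_mean_cvg h : continuous h ->
  exists c : R, forall e : R, 0 < e -> exists n, forall m a, (n <= m)%N ->
    `|iter_mean m h a - c| <= e.
Proof.
move=> ch; have [[a0 _]|nA] := pselect (exists a : A, True); last first.
  by exists 0 => e _; exists 0%N => m a; case: nA; exists a.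
pose S := [set v | exists n, forall x, v <= iter_mean n h x].
exists (sup S) => e e0; have [n Hn] := iter_mean_small_osc ch e0.
exists n => m a nm.
have osc := iter_mean_osc_mono nm Hn.
have low : S (iter_mean m h a - e).
  by exists m => x; rewrite lerBlDr addrC -lerBlDr.
have up v : S v -> v <= iter_mean m h a + e.
  move=> [k Hk]; have : v <= iter_mean (k + m) h a0.
    by rewrite addnC iter_meanD; exact: iter_mean_ge.
  move=> /le_trans; apply; rewrite iter_meanD; apply: iter_mean_le => z.
  by rewrite addrC -lerBlDr.
rewrite ler_norml; apply/andP; split.
  by rewrite lerBrDr addrC lerBlDr; apply: ge_sup => //; exists (iter_mean m h a - e).
rewrite lerBlDr -lerBlDl; apply: ub_le_sup => //.
by exists (iter_mean m h a + e).
Qed.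

Lemma subst_op_strongly_power_convergent :
  strongly_power_convergent (fun (f : A -> R) a => subst_op rho f a / L%:R).
Proof.
move=> f cf; have [c Hc] := iter_mean_cvg cf.
exists (fun=> c); split; first exact: continuous_cst_fun.
have iterE n : iter n (fun (f : A -> R) a => subst_op rho f a / L%:R) f =
    iter_mean n f.
  elim: n => [|n ih]; first by apply/funext => a; rewrite /iter_mean /= expn0 big_ord1 divr1.
  rewrite iterS ih; apply/funext => a; rewrite -add1n iter_meanD.
  by rewrite [RHS]iter_mean_subst_op /= expn1.
under eq_fun do rewrite iterE.
move=> Q /uniform_nbhs[E [entE EQ]]; rewrite !nbhs_simpl.
move: entE; rewrite -entourage_ballE => -[e /= e0 eE].
have [n Hn] := Hc (e / 2) (divr_gt0 e0 (ltr0Sn _ _)).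
exists n => // m /= nm; apply: EQ => a _; apply: eE.
rewrite /ball /= distrC; apply: le_lt_trans (Hn m a nm) _.
by rewrite ltr_pdivrMr// ltr_pMr// ltr1n.
Qed.

Lemma natural_length_constant (l : A -> R) : natural_length rho l ->
  exists2 c, 0 < c & forall a, l a = c.
Proof.
move=> [cl l0 [a0 la0] [lam lam0 lE]].
have la0_gt0 : 0 < l a0 by rewrite lt0r la0 l0.
have L0 := Ln_gt0 a0 1; rewrite expn1 in L0.
pose q := lam / L%:R.
have iterE n a : iter_mean n l a = q ^+ n * l a.
  elim: n a => [|n ih] a; first by rewrite /iter_mean expn0 big_ord1 divr1 mul1r.
  rewrite -addn1 addnC iter_meanD (_ : iter_mean n l = fun a => q ^+ n * l a).
    rewrite iter_mean_subst_op /= expn1 /subst_op -mulr_sumr.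
    by rewrite -/(subst_op rho l a) lE /q exprSr; ring.
  exact/funext.
have [c Hc] := iter_mean_cvg cl.
have l20 : 0 < l a0 / 2 by rewrite divr_gt0.
have [E entE El] := compact_unif_continuous A_compact cl l20.
have [P hitP] := primitive_hits entE.
(* Among the [L ^ P] letters below any [a] one is so close to [a0] that [l] is at least [l a0 / 2]
   there; the others contribute at least 0. *)
pose d := l a0 / 2 / (L ^ P)%:R.
have d0 : 0 < d by rewrite divr_gt0// (Ln_gt0 a0).
have low a : d <= iter_mean P l a.
  rewrite /iter_mean ler_wpM2r ?invr_ge0 ?ler0n//.
  have [j jP /El] := hitP a0 a; rewrite ler_norml => /andP[_].
  rewrite lerBlDr -lerBlDl => lj.
  rewrite (bigD1 (Ordinal jP))//= -[X in X <= _]addr0 lerD ?sumr_ge0//.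
  by apply: le_trans lj; rewrite {2}[l a0]splitr addrK.
exists (l a0) => // a; apply/eqP; rewrite -subr_eq0 -normr_le0.
apply/ler_addgt0Pr => e e0; rewrite add0r.
have d1 : 0 < d / l a0 by rewrite divr_gt0.
(* Two such errors add up to [d / l a0 * e], and the factor [d / l a0], a lower bound of
   [q ^+ (n + P)], then cancels. *)
have [n Hn] := Hc (d / l a0 * e / 2) (divr_gt0 (mulr_gt0 d1 e0) (ltr0Sn _ _)).
(* [iter_mean n l] is [q ^+ n * l], is bounded below by primitivity, and its
   oscillation vanishes. *)
have qn : d / l a0 <= q ^+ (n + P).
  by rewrite ler_pdivrMr// -iterE iter_meanD; exact: iter_mean_ge.
rewrite -(ler_pM2l d1); apply: (@le_trans _ _ (q ^+ (n + P) * `|l a - l a0|)).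
  by rewrite ler_wpM2r.
have q0 : 0 <= q ^+ (n + P) by rewrite exprn_ge0// divr_ge0// ltW.
rewrite -[X in X * _]ger0_norm// -normrM mulrBr -!iterE.
have -> : iter_mean (n + P) l a - iter_mean (n + P) l a0 =
    (iter_mean (n + P) l a - c) - (iter_mean (n + P) l a0 - c) by ring.
apply: le_trans (ler_normB _ _) _; rewrite [X in _ <= X]splitr.
by apply: lerD; apply: Hn; exact: leq_addr.
Qed.

End IteratedMeans.

(** * The spectral radius *)

Section Geometric.
Context {R : realType}.

Lemma expr_small (q C e : R) : 0 <= q -> q < 1 -> 0 < e ->
  exists n, C * q ^+ n <= e.
Proof.
move=> q0 q1 e0.
have qn : `|q| < 1 by rewrite ger0_norm.
have : (fun n => C * q ^+ n) @ \oo --> C * 0.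
  by apply: cvgM; [exact: cvg_cst|exact: cvg_expr].
rewrite mulr0 => /cvgrPdist_le/(_ _ e0)[n _ Hn]; exists n.
have /= := Hn n (leqnn n); rewrite sub0r normrN; apply: le_trans.
exact: ler_norm.
Qed.

Lemma geometric_le0 (q C x : R) : 0 <= q -> q < 1 ->
  (forall n, x <= C * q ^+ n) -> x <= 0.
Proof.
move=> q0 q1 H; apply/ler_addgt0Pr => e e0; rewrite add0r.
by have [n] := expr_small C q0 q1 e0; exact: le_trans.
Qed.

Lemma geometric_steps_cvg (u : nat -> R) (q C : R) : 0 <= q -> q < 1 ->
  (forall n, `|u n.+1 - u n| <= C * q ^+ n) ->
  exists l, forall n, `|u n - l| <= C / (1 - q) * q ^+ n.
Proof.
move=> q0 q1 uq; have q10 : 0 < 1 - q by rewrite subr_gt0.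
pose D := C / (1 - q).
have DE : D = C + D * q by rewrite /D; field; rewrite gt_eqF.
have D0 : 0 <= D.
  apply: divr_ge0; last exact: ltW.
  by have := uq 0%N; rewrite expr0 mulr1; exact: le_trans.
(* The intervals from [v n] to [w n] are nested because [D = C + D * q]; the supremum of the left
   ends lies in all of them. *)
pose v n := u n - D * q ^+ n; pose w n := u n + D * q ^+ n.
have step n : D * q ^+ n = C * q ^+ n + D * q ^+ n.+1.
  by rewrite {1}DE mulrDl exprS mulrA.
have vS n : v n <= v n.+1.
  by have := uq n; rewrite /v (step n) ler_norml => /andP[]; lra.
have wS n : w n.+1 <= w n.
  by have := uq n; rewrite /w (step n) ler_norml => /andP[]; lra.
have vw n : v n <= w n.
  by rewrite /v /w lerD2l -subr_ge0 opprK addr_ge0// mulr_ge0// exprn_ge0.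
have vm n m : v n <= v (n + m)%N.
  elim: m => [|m ih]; first by rewrite addn0.
  by rewrite addnS; exact: le_trans ih (vS _).
have wm n m : w (n + m)%N <= w n.
  elim: m => [|m ih]; first by rewrite addn0.
  by rewrite addnS; exact: le_trans (wS _) ih.
have vwm n m : v n <= w m.
  by apply: le_trans (vm n m) _; rewrite addnC; apply: le_trans (wm m n); exact: vw.
exists (sup (range v)) => n; rewrite -/D ler_norml.
have lo : v n <= sup (range v).
  by apply: ub_le_sup; [exists (w 0%N) => _ [m _ <-]|exists n].
have up : sup (range v) <= w n.
  by apply: ge_sup; [exists (v 0%N), 0%N|move=> _ [m _ <-]].
by move: lo up; rewrite /v /w => lo up; apply/andP; split; lra.
Qed.

End Geometric.

Lemma continuous_of_approx {R : realType} {T : topologicalType} (f : T -> R) :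
  (forall e : R, 0 < e -> exists2 g : T -> R, continuous g &
    forall x, `|f x - g x| <= e) -> continuous f.
Proof.
move=> H x; apply/cvgrPdist_le => e e0.
have [g cg fg] := H (e / 3) (divr_gt0 e0 (ltr0Sn _ _)).
have := cg x; move=> /cvgrPdist_le/(_ _ (divr_gt0 e0 (ltr0Sn _ 2))).
apply: filterS => y gxy.
have -> : f x - f y = (f x - g x) + (g x - g y) - (f y - g y) by ring.
apply: le_trans (ler_normB _ _) _.
apply: le_trans (lerD (ler_normD _ _) (lexx _)) _.
have := fg x; have := fg y; lra.
Qed.

Section SpectralRadius.
Context {R : realType} {A : topologicalType}.
Hypothesis A_compact : compact [set: A].
Variable rho : A -> nonempty_word A.
Hypothesis rho_continuous : continuous rho.
Variable L : nat.
Hypothesis rho_length : constant_length rho L.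
Implicit Types h k : A -> R[i].

Local Notation N := (@subst_op A rho R[i]).
Local Notation normc := (@ComplexField.Normc.normc R).
Import ComplexField.Normc.

Lemma Re_norm (z : R[i]) : complex.Re `|z| = normc z. Proof. by []. Qed.

Lemma normc_ge0 (z : R[i]) : 0 <= normc z.
Proof. by case: z => a b; exact: sqrtr_ge0. Qed.

Lemma normc_Re (z : R[i]) : `|complex.Re z| <= normc z.
Proof.
by case: z => a b /=; rewrite -sqrtr_sqr ler_wsqrtr// lerDl sqr_ge0.
Qed.

Lemma normc_Im (z : R[i]) : `|complex.Im z| <= normc z.
Proof.
by case: z => a b /=; rewrite -sqrtr_sqr ler_wsqrtr// lerDr sqr_ge0.
Qed.

Lemma normc_le (z : R[i]) : normc z <= `|complex.Re z| + `|complex.Im z|.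
Proof.
case: z => a b /=; rewrite -[X in _ <= X]ger0_norm ?addr_ge0//.
rewrite -sqrtr_sqr ler_wsqrtr// -[a ^+ 2]real_normK ?num_real//.
rewrite -[b ^+ 2]real_normK ?num_real// sqrrD -addrA lerD2l lerDr.
by rewrite mulrn_wge0// mulr_ge0.
Qed.

Lemma normc_sum (I : Type) (s : seq I) (F : I -> R[i]) :
  normc (\sum_(i <- s) F i) <= \sum_(i <- s) normc (F i).
Proof.
elim: s => [|i s ih]; first by rewrite !big_nil normc0.
by rewrite !big_cons (le_trans (le_normcD _ _))// lerD2l.
Qed.

Lemma normc_subst_op h (C : R) a : (forall b, normc (h b) <= C) ->
  normc (N h a) <= L%:R * C.
Proof.
move=> hC; rewrite (subst_opE rho_length).
apply: le_trans (normc_sum _ _) _; apply: le_trans (ler_sum _ (fun j _ => hC _)) _.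
by rewrite sumr_const card_ord mulr_natl.
Qed.

Lemma subst_opB h k a : N (fun b => h b - k b) a = N h a - N k a.
Proof. by rewrite /subst_op sumrB. Qed.

Lemma ccontinuous_subst_op h : ccontinuous h -> ccontinuous (N h).
Proof.
move=> [hr hi].
have H (p : R[i] -> R) : {morph p : x y / x + y} -> p 0 = 0 ->
    continuous (fun a => p (h a)) -> continuous (fun a => p (N h a)).
  move=> pD p0 ch; rewrite (_ : (fun a => p (N h a)) =
      fun a => \sum_(j < L) p (h (column rho j a))).
    apply: continuous_sumf => j a; apply: continuous_comp (ch _).
    exact: continuous_column.
  by apply/funext => a; rewrite (subst_opE rho_length) (big_morph p pD p0).
by split; apply: H => // -[a b] [c d].
Qed.

Lemma ccontinuousD h k : ccontinuous h -> ccontinuous k ->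
  ccontinuous (fun a => h a + k a).
Proof.
move=> [h1 h2] [k1 k2]; split.
  rewrite (_ : (fun _ => _) = fun a => complex.Re (h a) + complex.Re (k a)).
    exact: continuous_addf.
  by apply/funext => a; case: (h a); case: (k a).
rewrite (_ : (fun _ => _) = fun a => complex.Im (h a) + complex.Im (k a)).
  exact: continuous_addf.
by apply/funext => a; case: (h a); case: (k a).
Qed.

Lemma ccontinuousM (z : R[i]) h : ccontinuous h -> ccontinuous (fun a => z * h a).
Proof.
case: z => x y [h1 h2]; split.
  rewrite (_ : (fun _ => _) = fun a => x * complex.Re (h a) - y * complex.Im (h a)).
    by apply: continuous_subf; apply: continuous_mulf => //; exact: continuous_cst_fun.
  by apply/funext => a; case: (h a).
rewrite (_ : (fun _ => _) = fun a => x * complex.Im (h a) + y * complex.Re (h a)).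
  by apply: continuous_addf; apply: continuous_mulf => //; exact: continuous_cst_fun.
by apply/funext => a; case: (h a).
Qed.

Lemma ccontinuous_bounded h : ccontinuous h ->
  exists2 C : R, 0 <= C & forall a, normc (h a) <= C.
Proof.
move=> [h1 h2]; have [M M0 HM] := compact_bounded_fun A_compact h1.
have [K K0 HK] := compact_bounded_fun A_compact h2.
exists (M + K); first by rewrite addr_ge0// ltW.
by move=> a; rewrite (le_trans (normc_le _))// lerD.
Qed.

Section Resolvent.
Variable z : R[i].
Hypothesis Lz : L%:R < normc z.

Let z0 : 0 < normc z. Proof. by apply: le_lt_trans Lz; exact: ler0n. Qed.
Let z_neq0 : z != 0.
Proof. by apply/eqP => zE; move: z0; rewrite zE normc0 ltxx. Qed.
Let q : R := L%:R / normc z.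
Let q0 : 0 <= q. Proof. by rewrite divr_ge0 ?ler0n// ltW. Qed.
Let q1 : q < 1. Proof. by rewrite ltr_pdivrMr// mul1r. Qed.

Lemma resolvent_contract h (C : R) :
  (forall a, normc (h a) <= C) -> forall a, normc (z^-1 * N h a) <= q * C.
Proof.
move=> hC a; rewrite normcM normcV mulrC /q mulrAC ler_wpM2r//.
  by rewrite invr_ge0 ltW.
exact: normc_subst_op.
Qed.

Lemma resolvent_kernel h : ccontinuous h ->
  (forall a, z * h a = N h a) -> forall a, h a = 0.
Proof.
move=> ch zh a; have [C C0 hC] := ccontinuous_bounded ch.
have hE b : h b = z^-1 * N h b by rewrite -zh mulKf.
have bnd n b : normc (h b) <= C * q ^+ n.
  elim: n b => [|n ih] b; first by rewrite expr0 mulr1.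
  by rewrite hE exprS mulrCA; exact: resolvent_contract.
apply: eq0_normc; apply/eqP; rewrite eq_le normc_ge0 andbT.
exact: geometric_le0 q0 q1 (fun n => bnd n a).
Qed.

Lemma resolvent_surj k : ccontinuous k ->
  exists2 h, ccontinuous h & forall a, z * h a - N h a = k a.
Proof.
(* The iterates are the partial sums of the Neumann series. Consecutive differences shrink by the
   factor [q], and real and imaginary parts converge separately. *)
move=> ck; pose u := fix u n : A -> R[i] := if n is m.+1 then
  (fun a => z^-1 * (k a + N (u m) a)) else fun=> 0.
have cu n : ccontinuous (u n).
  elim: n => [|n ih] /=; first by split; exact: continuous_cst_fun.
  by apply: ccontinuousM; apply: ccontinuousD => //; exact: ccontinuous_subst_op.
have [C C0 kC] := ccontinuous_bounded (cu 1%N).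
have du n a : normc (u n.+1 a - u n a) <= C * q ^+ n.
  elim: n a => [|n ih] a; first by rewrite expr0 mulr1 subr0.
  rewrite [u n.+2]/= [X in _ - X]/= -mulrBr opprD addrACA subrr add0r -subst_opB.
  by rewrite exprS mulrCA; exact: resolvent_contract.
have /choice[hr Hr] : forall a, exists l, forall n,
    `|complex.Re (u n a) - l| <= C / (1 - q) * q ^+ n.
  move=> a; apply: (geometric_steps_cvg (u := fun n => complex.Re (u n a)) q0 q1).
  move=> n; apply: le_trans (du n a); apply: le_trans (normc_Re _).
  by case: (u n.+1 a); case: (u n a).
have /choice[hi Hi] : forall a, exists l, forall n,
    `|complex.Im (u n a) - l| <= C / (1 - q) * q ^+ n.
  move=> a; apply: (geometric_steps_cvg (u := fun n => complex.Im (u n a)) q0 q1).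
  move=> n; apply: le_trans (du n a); apply: le_trans (normc_Im _).
  by case: (u n.+1 a); case: (u n a).
pose D := C / (1 - q); pose h a := Complex (hr a) (hi a).
have ch : ccontinuous h.
  split; apply: continuous_of_approx => e e0.
    have [n Hn] := expr_small D q0 q1 e0.
    exists (fun a => complex.Re (u n a)); first by have [] := cu n.
    by move=> a; rewrite distrC /=; apply: le_trans Hn; exact: Hr.
  have [n Hn] := expr_small D q0 q1 e0.
  exists (fun a => complex.Im (u n a)); first by have [] := cu n.
  by move=> a; rewrite distrC /=; apply: le_trans Hn; exact: Hi.
have hu n a : normc (h a - u n a) <= D *+ 2 * q ^+ n.
  apply: le_trans (normc_le _) _; rewrite mulr2n mulrDl.
  have := Hr a n; have := Hi a n; rewrite -/D /h; case: (u n a) => x y /= ? ?.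
  by rewrite distrC [X in _ + X]distrC lerD.
exists h => // a; apply/eqP; rewrite -subr_eq0; apply/eqP; apply: eq0_normc.
apply/eqP; rewrite eq_le normc_ge0 andbT.
apply: (geometric_le0 (C := D *+ 2 * (normc z * q + L%:R)) q0 q1) => n.
have uE : z * u n.+1 a = k a + N (u n) a by rewrite /= mulVKf.
(* The residual of [h] is written through the errors of two consecutive iterates, so it is bounded
   by a geometric sequence and vanishes. *)
have -> : z * h a - N h a - k a =
    z * (h a - u n.+1 a) - N (fun b => h b - u n b) a.
  by rewrite mulrBr uE subst_opB; ring.
apply: le_trans (le_normcD _ _) _; rewrite normcN normcM mulrDr mulrDl; apply: lerD.
  apply: le_trans (ler_wpM2l (normc_ge0 z) (hu _ _)) _.
  by rewrite exprS le_eqVlt; apply/orP; left; apply/eqP; ring.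
apply: le_trans (normc_subst_op _ (hu n)) _.
by rewrite le_eqVlt; apply/orP; left; apply/eqP; ring.
Qed.

Lemma resolvent_not_spectrum : ~ spectrum N z.
Proof.
apply; move=> k ck; have [h ch hE] := resolvent_surj ck.
exists h; split; first by split => //; apply/funext.
move=> g [cg gE]; apply/funext => a.
have gEa b : z * g b - N g b = k b by have := congr1 (fun f => f b) gE.
apply/eqP; rewrite -subr_eq0; apply/eqP.
apply: (@resolvent_kernel (fun b => h b - g b)).
  rewrite (_ : (fun _ => _) = fun b => h b + (-1) * g b).
    by apply: ccontinuousD => //; exact: ccontinuousM.
  by apply/funext => b; rewrite mulN1r.
move=> b; rewrite subst_opB; apply/eqP; rewrite -subr_eq0 mulrBr.
by rewrite [X in X == _](_ : _ = (z * h b - N h b) - (z * g b - N g b));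
  [rewrite hE gEa subrr|ring].
Qed.

End Resolvent.

Lemma spectral_radius_constant_length (a0 : A) :
  spectral_radius (subst_op rho) = L%:R :> R.
Proof.
rewrite /spectral_radius; set S := [set _ | _ in _].
(* At [z = L] the equation with right-hand side 0 is solved by the constants 0 and 1, which differ
   at [a0]. *)
have SL : S L%:R.
  exists (L%:R : R[i]); last first.
    rewrite -(rmorph_nat (real_complex R)) Re_norm /= expr0n addr0 sqrtr_sqr.
    by rewrite ger0_norm.
  move=> /(_ (fun=> 0)) [|h [_ uniq]].
    by split; exact: continuous_cst_fun.
  have N0 : h = (fun=> 0).
    apply: uniq; split; first by split; exact: continuous_cst_fun.
    by apply/funext => a; rewrite /subst_op big1// mulr0 subr0.
  have N1 : h = (fun=> 1).
    apply: uniq; split; first by split; exact: continuous_cst_fun.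
    apply/funext => a; rewrite (subst_opE rho_length) sumr_const card_ord.
    by rewrite mulr1 subrr.
  have : (0 : R[i]) = 1 by rewrite -[LHS](congr1 (fun f => f a0) N0) N1.
  by move/eqP; rewrite eq_sym oner_eq0.
have ubS : ubound S L%:R.
  move=> _ [z zN <-]; rewrite leNgt; apply/negP => Lz.
  exact: resolvent_not_spectrum Lz zN.
apply/eqP; rewrite eq_le; apply/andP; split.
  by apply: ge_sup => //; exists L%:R.
by apply: ub_le_sup => //; exists L%:R.
Qed.

End SpectralRadius.

(** * Birkhoff sums over the subshift *)

Lemma cvg_ptws {I : eqType} {V : topologicalType} (F : set_system (I -> V))
    (f : I -> V) : Filter F ->
  (forall i, (fun g : I -> V => g i) @ F --> f i) -> {ptws, F --> f}.
Proof.
move=> FF H; apply/cvg_sup => i; apply/cvg_image.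
  by rewrite eqEsubset; split=> v // _; exists (cst v).
move=> W /= /H; rewrite nbhs_simpl /= => Q.
exists (@^~ i @^-1` W) => //.
by rewrite eqEsubset; split => [j [? + <-//]|j Wj]; exists (fun _ => j).
Qed.

Lemma continuous_ptws {I : eqType} {T V : topologicalType} (f : T -> I -> V) :
  (forall i, continuous (fun t => f t i)) -> continuous (f : T -> {ptws I -> V}).
Proof. by move=> cf t; apply: cvg_ptws => i; exact: cf. Qed.

Lemma continuous_ptws_eval {I : eqType} {V : topologicalType} (i : I) :
  continuous (fun x : {ptws I -> V} => x i).
Proof. exact: (@proj_continuous I (fun=> V) i). Qed.

Lemma near_forall_lt {T : Type} (F : set_system T) (P : nat -> T -> Prop) n :
  Filter F -> (forall k, \forall x \near F, P k x) ->
  \forall x \near F, forall k, (k < n)%N -> P k x.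
Proof.
move=> FF H; have := @filter_forall _ 'I_n (fun k x => P k x) F FF (fun k => H k).
by apply: filterS => x Hx k kn; exact: (Hx (Ordinal kn)).
Qed.

Lemma near_window {T : Type} (F : set_system T) (P : int -> T -> Prop) m :
  Filter F -> (forall k, \forall x \near F, P k x) ->
  \forall x \near F, forall k : int, (`|k| <= m)%N -> P k x.
Proof.
move=> FF H.
have H1 := near_forall_lt m.+1 FF (fun k => H (Posz k)).
have H2 := near_forall_lt m.+1 FF (fun k => H (- Posz k)).
apply: filterS2 H1 H2 => x H1 H2 k km.
have [k0|k0] := leP 0 k.
  by rewrite -(gez0_abs k0); apply: H1.
have -> : k = - (Posz `|k|%N) by rewrite ltz0_abs// opprK.
exact: H2.
Qed.

(** * Windows and uniform continuity on the space of sequences *)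

Section Sequences.
Context {R : realType} {A : uniformType}.
Hypothesis A_compact : compact [set: A].

Local Notation S := {ptws int -> A}.

Definition shift_by (k : int) (x : int -> A) : int -> A := fun i => x (i + k).

Lemma shift_byD k j x : shift_by k (shift_by j x) = shift_by (k + j) x.
Proof. by apply/funext => i; rewrite /shift_by addrA. Qed.

Lemma shift_by0 x : shift_by 0 x = x.
Proof. by apply/funext => i; rewrite /shift_by addr0. Qed.

Lemma continuous_shift_by k : continuous (shift_by k : S -> S).
Proof. by apply: continuous_ptws => i; exact: continuous_ptws_eval. Qed.

Lemma compact_sequences : compact [set: S].
Proof.
have := @tychonoff int (fun=> A) (fun=> setT) (fun=> A_compact).
by congr compact; apply/seteqP; split.
Qed.

Lemma nbhs_window (x : S) (m : nat) (E : set (A * A)) : entourage E ->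
  nbhs x [set y : S | forall i : int, (`|i| <= m)%N -> E (x i, y i)].
Proof.
move=> entE.
apply: (@near_window S (nbhs x) (fun i (y : S) => E (x i, y i)) m).
move=> i; apply: (@continuous_ptws_eval _ A i x [set a | E (x i, a)]).
by apply: filterS (nbhs_entourage (x i) entE) => a /xsectionP.
Qed.

(** The sets containing a window neighbourhood of [x] form a filter that converges to [x] in each
    coordinate, hence in the product topology. *)
Lemma window_nbhs (x : S) (V : set S) : nbhs x V ->
  exists m, exists2 E : set (A * A), entourage E &
    forall y : S, (forall i : int, (`|i| <= m)%N -> E (x i, y i)) -> V y.
Proof.
pose F : set_system S := [set W | exists m, exists2 E : set (A * A), entourage E &
    forall y : S, (forall i : int, (`|i| <= m)%N -> E (x i, y i)) -> W y].
have FF : Filter F.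
  split.
  - by exists 0%N; exists setT => //; exact: entourageT.
  - move=> P Q [m [E entE HP]] [n [D entD HQ]].
    exists (maxn m n); exists (E `&` D); first exact: filterI.
    move=> y Hy; split.
      by apply: HP => i im; have [] := Hy i (leq_trans im (leq_maxl _ _)).
    by apply: HQ => i im; have [] := Hy i (leq_trans im (leq_maxr _ _)).
  - by move=> P Q PQ [m [E entE HP]]; exists m; exists E => // y /HP /PQ.
suff : F --> x by apply.
apply: cvg_ptws => i W /nbhsP[E entE EW].
by exists `|i|%N; exists E => // y /(_ i (leqnn _)) Exy; apply: EW; apply/xsectionP.
Qed.

(** Heine-Cantor again, with closeness of sequences measured by a window radius and an entourage of
    [A]; the covering argument runs over such pairs. *)
Lemma window_unif_continuous (G : S -> R) (e : R) : continuous G -> 0 < e ->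
  exists m, exists2 E : set (A * A), entourage E &
    forall x y : S, (forall i : int, (`|i| <= m)%N -> E (x i, y i)) ->
      `|G x - G y| <= e.
Proof.
move=> cG e0; have [[a _]|nA] := pselect (exists a : A, True); last first.
  exists 0%N; exists setT; first exact: entourageT.
  by move=> x; case: nA; exists (x 0).
have PF : ProperFilter (@entourage A).
  by split; [by move=> /(@entourage_refl _ _ a)|exact: entourage_filter].
have e20 : 0 < e / 2 by rewrite divr_gt0.
pose P (mE : nat * set (A * A)) (x : S) := forall y : S,
  (forall i : int, (`|i| <= mE.1)%N -> mE.2 (x i, y i)) -> `|G x - G y| <= e.
have /compact_near_coveringP cov := compact_sequences.
pose F := filter_prod \oo (powerset_filter_from (@entourage A)).
have : \forall mE \near F, [set: S] `<=` P mE.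
  apply: cov => x0 _.
  have := cG x0; move/cvgrPdist_lt => /(_ _ e20)/window_nbhs[m [E entE HE]].
  have [E1 entE1 E11] := entourage_split_ex entE.
  exists ([set x : S | forall i : int, (`|i| <= m)%N -> E1 (x0 i, x i)],
          [set mE | (m <= mE.1)%N /\ mE.2 `<=` E1]).
    split => /=; first exact: nbhs_window.
    exists ([set n | (m <= n)%N], [set D | D `<=` E1]).
      by split => /=; [exact: nbhs_infty_ge|exact: small_set_sub].
    by move=> [n D] [].
  move=> [x [n D]] [/= x0x [mn DE]] y xy.
  have hx : `|G x0 - G x| < e / 2.
    apply: HE => i im; apply: E11; exists (x i); first exact: x0x.
    exact: entourage_refl.
  have hy : `|G x0 - G y| < e / 2.
    apply: HE => i im; apply: E11; exists (x i); first exact: x0x.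
    by apply: DE; apply: xy; exact: leq_trans mn.
  rewrite (splitr e); have -> : G x - G y = (G x0 - G y) - (G x0 - G x) by ring.
  by apply: le_trans (ler_normB _ _) _; rewrite addrC lerD// ltW.
move=> [[Q1 Q2] [/= /filter_ex[m Q1m] Q2F] Q12].
have [E [entE Q2E]] : exists E, entourage E /\ Q2 E.
  have H := near_small_set PF.
  by have [E [? ?]] := filter_ex (filterI H Q2F); exists E.
by exists m; exists E => // x y; apply: (Q12 (m, E)).
Qed.

End Sequences.

Section BlockSums.
Context {R : realType}.
Implicit Types F : nat -> R.

Lemma big_nat_blocks F K B :
  \sum_(0 <= j < K * B) F j = \sum_(0 <= b < K) \sum_(0 <= t < B) F (b * B + t)%N.
Proof.
rewrite big_nat_mul; apply: eq_bigr => b _.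
rewrite -{1}[(b * B)%N]add0n big_addn mulSn addnK.
by apply: eq_bigr => t _; rewrite addnC.
Qed.

Lemma sum_indic_lt m N : \sum_(0 <= j < N) (j < m)%:R <= m%:R :> R.
Proof.
elim: N => [|N ih]; first by rewrite big_geq.
rewrite big_nat_recr//=; case: ltnP => Nm; last by rewrite addr0.
have -> : \sum_(0 <= j < N) (j < m)%:R = N%:R :> R.
  rewrite (eq_big_nat _ _ (F2 := fun=> 1)) ?sumr_const_nat ?subn0// => j /andP[_ jN].
  by rewrite (ltn_trans jN Nm).
by rewrite natr1 ler_nat.
Qed.

Lemma sum_indic_ge m N : \sum_(0 <= j < N) (N <= j + m)%:R <= m%:R :> R.
Proof.
rewrite big_nat_rev /=; apply: le_trans (sum_indic_lt m N).
rewrite le_eqVlt; apply/orP; left; apply/eqP; apply: eq_big_nat => j /andP[_ jN].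
by congr (_%:R); congr nat_of_bool; lia.
Qed.

Lemma sum_window_le F (e M : R) m N : 0 <= e -> 0 <= M ->
  (forall j, (j < N)%N -> `|F j| <= M) ->
  (forall j, (m <= j)%N -> (j + m < N)%N -> `|F j| <= e) ->
  `|\sum_(0 <= j < N) F j| <= N%:R * e + 2 * m%:R * M.
Proof.
move=> e0 M0 FM Fe.
apply: le_trans (ler_norm_sum _ _ _) _.
(* Indices away from the ends cost [e]; an index within [m] of an end is charged an extra [M] for
   that end. *)
apply: (@le_trans _ _ (\sum_(0 <= j < N) (e + (j < m)%:R * M + (N <= j + m)%:R * M))).
  apply: ler_sum_nat => j /andP[_ jN].
  case: ltnP => jm; case: leqP => jN' //=; rewrite ?mul1r ?mul0r ?addr0.
  - by have := FM j jN; lra.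
  - by have := FM j jN; lra.
  - by have := FM j jN; lra.
  - exact: Fe.
rewrite !big_split /= sumr_const_nat subn0 -[e *+ N]mulr_natl -!mulr_suml -addrA lerD2l.
rewrite -mulrA mulr_natl mulr2n.
by apply: lerD; rewrite ler_wpM2r// ?sum_indic_lt ?sum_indic_ge.
Qed.

End BlockSums.

Section Birkhoff.
Context {R : realType} {A : uniformType}.
Hypothesis A_compact : compact [set: A].
Variable rho : A -> nonempty_word A.
Hypothesis rho_continuous : continuous rho.
Hypothesis rho_primitive : primitive rho.
Variable L : nat.
Hypothesis rho_length : constant_length rho L.
Hypothesis rho_equicontinuous :
  uniformly_equicontinuous (column_semigroup rho L).
Hypothesis L_gt1 : (1 < L)%N.

Local Notation S := {ptws int -> A}.
Local Notation col := (iter_column rho L).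

(* The word rho^p(b) sits on [0, L^p); the letters elsewhere are junk. *)
Definition seed p (b : A) : S := fun i => col p `|i| b.

Let Lp_gt0 p : 0 < (L ^ p)%:R :> R.
Proof. by rewrite ltr0n expn_gt0 (ltnW L_gt1). Qed.

Lemma continuous_seed p : continuous (seed p).
Proof. by apply: continuous_ptws => i; exact: continuous_iter_column. Qed.

(** Words of length [n] form an open summand of the word space, so a word in the closure is
    approximated letter by letter by a generated word of the same length. *)
Lemma subshift_approx (x : int -> A) (E : set (A * A)) (i0 : int) n :
  subshift rho x -> entourage E ->
  exists k a i, (i + n <= L ^ k)%N /\
    forall j, (j < n)%N -> E (x (i0 + j%:Z), col k (i + j) a).
Proof.
move=> Xx entE; have := Xx i0 n.
set u0 : {ptws 'I_n -> A} := fun j => x (i0 + j%:Z).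
pose B : set (word A) :=
  existT (fun m => {ptws 'I_m -> A}) n @` [set u | forall j, E (u0 j, u j)].
move=> /(_ B)[].
  apply: existT_nbhs.
  apply: (@filter_forall _ 'I_n (fun j (u : {ptws 'I_n -> A}) => E (u0 j, u j))
    (nbhs u0)).
  move=> j; apply: (@continuous_ptws_eval _ A j u0 [set a | E (u0 j, a)]).
  by apply: filterS (nbhs_entourage (u0 j) entE) => a /xsectionP.
move=> w [[k [a /infixP[s1 [s2 sE]]]] [u Eu wE]]; subst w.
move: sE; rewrite /letters /= => sE; exists k, a, (size s1).
have szE : size (subst_iter rho k a) = (size s1 + (n + size s2))%N.
  by rewrite sE !size_cat size_map size_enum_ord.
rewrite (size_subst_iter rho_length) in szE; split.
  by rewrite szE leq_add2l leq_addr.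
move=> j jn; rewrite -(nth_subst_iter rho_length a); last first.
  by rewrite szE ltn_add2l (leq_trans jn)// leq_addr.
rewrite sE nth_cat ltnNge leq_addr /= addKn nth_cat size_map size_enum_ord jn.
have := Eu (Ordinal jn); rewrite /u0 /=; congr (E (_, _)).
rewrite (nth_map (Ordinal jn)) ?size_enum_ord//; congr (u _).
by apply: val_inj; rewrite /= nth_enum_ord.
Qed.

Section Observable.
Variable G : S -> R.
Hypothesis G_continuous : continuous G.

Definition block_mean p (b : A) : R :=
  (\sum_(0 <= j < L ^ p) G (shift_by j%:Z (seed p b))) / (L ^ p)%:R.

Lemma continuous_block_mean p : continuous (block_mean p).
Proof.
apply: continuous_mulf; last exact: continuous_cst_fun.
apply: continuous_sumf => j b.
apply: (@continuous_comp _ _ _ (seed p) (fun x => G (shift_by j%:Z x))).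
  exact: continuous_seed.
apply: (@continuous_comp _ _ _ (shift_by j%:Z : S -> S) G).
  exact: continuous_shift_by.
exact: G_continuous.
Qed.

Section Windows.
Variables (e M : R) (m : nat) (E : set (A * A)).
Hypothesis e0 : 0 <= e.
Hypothesis GM : forall x, `|G x| <= M.
Hypothesis GE : forall x y : S,
  (forall i : int, (`|i| <= m)%N -> E (x i, y i)) -> `|G x - G y| <= e.
Hypothesis entE : entourage E.

(** Windows of radius [m] inside the block see close letters. At most [2 * m] windows overlap its
    ends, where nothing is known about the letters, and each is charged [2 * M]. *)
Lemma block_sum_dist (x y : S) (n : int) N :
  (forall t, (t < N)%N -> E (x (n + t%:Z), y t%:Z)) ->
  `|\sum_(0 <= j < N) G (shift_by (n + j%:Z) x) -
    \sum_(0 <= j < N) G (shift_by j%:Z y)| <= N%:R * e + 4 * m%:R * M.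
Proof.
move=> Exy; rewrite -sumrB.
have -> : 4 * m%:R * M = 2 * m%:R * (2 * M) by ring.
apply: sum_window_le => //.
- by rewrite mulr_ge0//; apply: le_trans (GM x).
- move=> j _; apply: le_trans (ler_normB _ _) _.
  by rewrite mulr2n mulrDl mul1r lerD.
- move=> j mj jN; apply: GE => i im; rewrite /shift_by.
  have [t [tN tE]] : exists t, (t < N)%N /\ i + j%:Z = t%:Z.
    by exists `|(i + j%:Z)%R|%N; lia.
  have -> : i + (n + j%:Z) = n + t%:Z by lia.
  by rewrite tE; exact: Exy.
Qed.

Lemma block_mean_sum p b :
  (L ^ p)%:R * block_mean p b = \sum_(0 <= j < L ^ p) G (shift_by j%:Z (seed p b)).
Proof. by rewrite mulrC /block_mean divfK// gt_eqF. Qed.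

Lemma block_mean_le p b : `|block_mean p b| <= M.
Proof.
rewrite /block_mean normrM normfV (gtr0_norm (Lp_gt0 p)) ler_pdivrMr//.
apply: le_trans (ler_norm_sum _ _ _) _.
apply: le_trans (ler_sum _ (fun j _ => GM _)) _.
by rewrite sumr_const_nat subn0 mulr_natr.
Qed.

Lemma blocks_sum_dist p K (x : S) (n : int) (b : nat -> A) :
  (forall k t, (k < K)%N -> (t < L ^ p)%N ->
    E (x (n + (k * L ^ p + t)%:Z), col p t (b k))) ->
  `|\sum_(0 <= j < K * L ^ p) G (shift_by (n + j%:Z) x) -
    \sum_(0 <= k < K) (L ^ p)%:R * block_mean p (b k)| <=
  K%:R * ((L ^ p)%:R * e + 4 * m%:R * M).
Proof.
move=> Hx; rewrite big_nat_blocks -sumrB; apply: le_trans (ler_norm_sum _ _ _) _.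
apply: (@le_trans _ _ (\sum_(0 <= k < K) ((L ^ p)%:R * e + 4 * m%:R * M))).
  apply: ler_sum_nat => k /andP[_ kK]; rewrite block_mean_sum.
  under eq_bigr do rewrite PoszD addrA.
  by apply: block_sum_dist => t tL; rewrite -addrA -PoszD; exact: Hx.
by rewrite sumr_const_nat subn0 -[X in X <= _]mulr_natl.
Qed.

Lemma block_meanD p q b :
  `|block_mean (p + q) b - iter_mean rho L q (block_mean p) b| <=
  e + 4 * m%:R * M / (L ^ p)%:R.
Proof.
have := @blocks_sum_dist p (L ^ q) (seed (p + q) b) 0 (fun k => col q k b).
under [X in `|X - _|]eq_bigr do rewrite add0r.
rewrite -expnD (addnC q p) -block_mean_sum -mulr_sumr big_mkord => H.
have {}H : `|(L ^ (p + q))%:R * (block_mean (p + q) b -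
    iter_mean rho L q (block_mean p) b)| <=
    (L ^ (p + q))%:R * (e + 4 * m%:R * M / (L ^ p)%:R).
  rewrite mulrBr; apply: le_trans (le_trans (H _) _); last 1 first.
  - rewrite expnD natrM le_eqVlt; apply/orP; left; apply/eqP; field.
    by rewrite gt_eqF.
  - rewrite le_eqVlt; apply/orP; left; apply/eqP; congr (`|_ - _|).
    by rewrite /iter_mean expnD natrM; field; rewrite gt_eqF.
  move=> k t kq tp; rewrite add0r /seed absz_nat (iter_columnD rho_length).
    rewrite modnMDl modn_small// divnMDl ?expn_gt0 ?(ltnW L_gt1)//.
    by rewrite divn_small// addn0; exact: entourage_refl.
  rewrite addnC expnD; apply: leq_trans (_ : k.+1 * L ^ p <= _)%N.
    by rewrite mulSn ltn_add2r.
  by rewrite [X in (_ <= X)%N]mulnC leq_mul2r kq orbT.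
by move: H; rewrite normrM (gtr0_norm (Lp_gt0 _)) ler_pM2l.
Qed.

End Windows.

Lemma archi_expn (C : R) : exists p, forall q, (p <= q)%N -> C <= (L ^ q)%:R.
Proof.
have [n nC] : exists n : nat, C <= n%:R.
  exists (Num.bound `|C|); apply: le_trans (ler_norm C) _.
  by rewrite ltW// archi_boundP.
exists n => q nq; apply: le_trans nC _; rewrite ler_nat.
by rewrite (leq_trans nq)// ltnW// ltn_expl.
Qed.

Lemma block_mean_small_osc (e : R) p0 : 0 < e ->
  exists2 p, (p0 <= p)%N & forall a b, `|block_mean p a - block_mean p b| <= e.
Proof.
(* Comparing with [T^q h_p] at [a] and at [b] costs [2 * d] each, and its oscillation costs the
   fifth [d]. *)
move=> e_gt0; pose d := e / 5; have d0 : 0 < d by rewrite divr_gt0.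
have [M M0 GM] := compact_bounded_fun (compact_sequences A_compact) G_continuous.
have [m [E entE GE]] := window_unif_continuous A_compact G_continuous d0.
have [p1 Hp1] := archi_expn (4 * m%:R * M / d).
pose p := maxn p0 p1.
have [q Hq] := iter_mean_small_osc A_compact rho_primitive rho_length
  rho_equicontinuous (continuous_block_mean (p := p)) d0.
have near b : `|block_mean (p + q) b - iter_mean rho L q (block_mean p) b| <= 2 * d.
  apply: le_trans (block_meanD (ltW d0) GM GE entE p q b) _.
  have -> : 2 * d = d + d by ring.
  rewrite lerD2l ler_pdivrMr// [d * _]mulrC -ler_pdivrMr//.
  by apply: Hp1; exact: leq_maxr.
exists (p + q)%N; first by rewrite (leq_trans (leq_maxl p0 p1))// leq_addr.
move=> a b.
have := near a; have := near b; have := Hq a b; have := Hq b a.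
have : e = 5 * d by rewrite /d; field.
by rewrite !ler_norml => -> ? ? /andP[? ?] /andP[? ?]; apply/andP; split; lra.
Qed.

Lemma subshift_birkhoff (e : R) : 0 < e -> exists N c, (0 < N)%N /\
  forall x : S, subshift rho x ->
    `|\sum_(0 <= j < N) G (shift_by j%:Z x) - N%:R * c| <= N%:R * e.
Proof.
move=> e_gt0; have [[a0 _]|nA] := pselect (exists a : A, True); last first.
  by exists 1%N, 0; split => // x; case: nA; exists (x 0).
(* One share each goes to windows inside blocks, windows overlapping block ends, the oscillation of
   block means, and the incomplete blocks at the two ends of the word. *)
pose d := e / 4; have d0 : 0 < d by rewrite divr_gt0.
have eE : e = 4 * d by rewrite /d; field.
have [M M0 GM] := compact_bounded_fun (compact_sequences A_compact) G_continuous.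
have [m [E entE GE]] := window_unif_continuous A_compact G_continuous d0.
have [p1 Hp1] := archi_expn (4 * m%:R * M / d).
have [p p1p Hp] := block_mean_small_osc p1 d0.
pose B := (L ^ p)%N; pose c := block_mean p a0.
(* The incomplete blocks have [B] letters in total; together with the term [B * c] they cost at most
   [2 * B * M], which [K] full blocks outweigh. *)
have [K HK] : exists K : nat, 2 * M / d <= K%:R.
  exists (Num.bound (2 * M / d)).
  by rewrite ltW// archi_boundP// ltW// divr_gt0// mulr_gt0.
have B0 : (0 < B)%N by rewrite expn_gt0 ltnW.
have BR0 : 0 < B%:R :> R by rewrite ltr0n.
exists (K.+1 * B)%N, c; split; first by rewrite muln_gt0.
move=> x Xx; have [k [a [i [ik Hx]]]] := subshift_approx 0 (K.+1 * B) Xx entE.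
have pk : (p <= k)%N.
  rewrite -(leq_exp2l _ _ L_gt1); apply: leq_trans ik.
  by rewrite (leq_trans _ (leq_addl _ _))// -/B leq_pmull.
(* The next block boundary strictly after position [i] is [s <= B] letters away, so [K] full blocks
   fit into [K.+1 * B] letters wherever the word starts. *)
pose s := (B - i %% B)%N; pose i1 := (i %/ B).+1.
have sB : (s <= B)%N by rewrite leq_subr.
have is1 : (i + s = i1 * B)%N.
  rewrite {1}(divn_eq i B) /s -addnA subnKC ?(ltnW (ltn_pmod _ B0))//.
  by rewrite /i1 mulSn addnC.
rewrite (@big_cat_nat _ _ _ s) //=; last first.
  by rewrite mulSn (leq_trans sB)// leq_addr.
rewrite (@big_cat_nat _ _ _ (s + K * B)%N s) /=; last 2 first.
- exact: leq_addr.
- by rewrite mulSn leq_add2r.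
set S1 := \sum_(0 <= j < s) _; set S3 := \sum_(s + K * B <= j < _) _.
set S2 := \sum_(s <= j < _) _.
have H1 : `|S1| <= s%:R * M.
  apply: le_trans (ler_norm_sum _ _ _) _.
  apply: le_trans (ler_sum _ (fun j _ => GM _)) _.
  by rewrite sumr_const_nat subn0 mulr_natl.
have H3 : `|S3| <= (B%:R - s%:R) * M.
  apply: le_trans (ler_norm_sum _ _ _) _.
  apply: le_trans (ler_sum _ (fun j _ => GM _)) _.
  by rewrite sumr_const_nat mulSn subnDr -[X in X <= _]mulr_natl natrB.
have cM : `|c| <= M by exact: block_mean_le.
pose b j := col (k - p) (i1 + j) a.
have H2 : `|S2 - \sum_(0 <= j < K) B%:R * block_mean p (b j)| <=
    K%:R * (B%:R * d + 4 * m%:R * M).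
  have -> : S2 = \sum_(0 <= j < K * B) G (shift_by (s%:Z + j%:Z) x).
    rewrite /S2 -{1}[s]add0n big_addn addnC addnK.
    by apply: eq_bigr => j _; rewrite addnC PoszD.
  apply: (blocks_sum_dist (ltW d0) GM GE) => j t jK tB.
  have jt : (j * B + t < K * B)%N.
    apply: leq_trans (_ : j.+1 * B <= _)%N; first by rewrite mulSnr ltn_add2l.
    by rewrite leq_mul2r jK orbT.
  have := Hx (s + (j * B + t))%N; rewrite add0r -PoszD.
  have -> : (i + (s + (j * B + t)) = (i1 + j) * B + t)%N.
    by rewrite addnA is1 addnA mulnDl.
  move=> /(_ _)H; have {}H := H _.
  have sn : (s + (j * B + t) < K.+1 * B)%N.
    by rewrite mulSn -addnS leq_add.
  have {H} := H sn; rewrite -{1}(subnKC pk) (iter_columnD rho_length).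
    by rewrite modnMDl modn_small// divnMDl// divn_small// addn0.
  rewrite subnKC//; apply: leq_trans ik.
  have -> : ((i1 + j) * B + t = i + (s + (j * B + t)))%N.
    by rewrite addnA is1 addnA mulnDl.
  by rewrite ltn_add2l.
have H4 : `|\sum_(0 <= j < K) B%:R * block_mean p (b j) - K%:R * (B%:R * c)| <=
    K%:R * (B%:R * d).
  have -> : K%:R * (B%:R * c) = \sum_(0 <= j < K) B%:R * c.
    by rewrite sumr_const_nat subn0 mulr_natl.
  rewrite -sumrB; apply: le_trans (ler_norm_sum _ _ _) _.
  apply: (@le_trans _ _ (\sum_(0 <= j < K) B%:R * d)); last first.
    by rewrite sumr_const_nat subn0 -[X in X <= _]mulr_natl.
  apply: ler_sum => j _; rewrite -mulrBr normrM ger0_norm ?ler0n//.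
  by rewrite ler_pM2l//; exact: Hp.
have H5 : 4 * m%:R * M <= B%:R * d by rewrite -ler_pdivrMr//; exact: Hp1.
have H6 : K%:R * (4 * m%:R * M) <= K%:R * (B%:R * d) by rewrite ler_wpM2l.
have H7 : B%:R * (2 * M) <= B%:R * (K%:R * d).
  by rewrite ler_pM2l// -ler_pdivrMr.
have H8 : `|B%:R * c| <= B%:R * M by rewrite normrM ger0_norm ?ler0n// ler_pM2l.
have H9 : 0 <= B%:R * d by rewrite mulr_ge0// ltW.
rewrite natrM -natr1 eE.
have -> : S1 + (S2 + S3) - (K%:R + 1) * B%:R * c =
   S1 + S3 + (S2 - \sum_(0 <= j < K) B%:R * block_mean p (b j)) +
   (\sum_(0 <= j < K) B%:R * block_mean p (b j) - K%:R * (B%:R * c)) - B%:R * c.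
  by ring.
apply: le_trans (ler_normB _ _) _.
apply: le_trans (lerD (ler_normD _ _) H8) _.
apply: le_trans (lerD (lerD (ler_normD _ _) H4) (lexx _)) _.
apply: le_trans (lerD (lerD (lerD (ler_normD _ _) H2) (lexx _)) (lexx _)) _.
apply: le_trans (lerD (lerD (lerD (lerD H1 H3) (lexx _)) (lexx _)) (lexx _)) _.
have H10 : 0 <= K%:R * (B%:R * d) by rewrite mulr_ge0.
move: H6 H7 H9 H10; lra.
Qed.

End Observable.

End Birkhoff.

(** * The tiling space *)

Section SetType.
Context {X : topologicalType} (B : set X).

Lemma continuous_set_type {T : topologicalType} (f : T -> B) :
  continuous (fun t => set_val (f t)) -> continuous f.
Proof. by move=> cf; exact: continuous_comp_initial. Qed.

Lemma set_type_hausdorff : hausdorff_space X -> hausdorff_space (set_type B).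
Proof.
move=> hX x y xy; apply: val_inj; apply: hX => U V Ux Vy.
have [z [Uz Vz]] := xy _ _ (@initial_continuous (set_type B) X set_val x U Ux)
  (@initial_continuous (set_type B) X set_val y V Vy).
by exists (set_val z).
Qed.

Lemma set_type_compact : compact B -> compact [set: set_type B].
Proof.
move=> cB F PF _.
have [|p [Bp Fp]] := cB (set_val @ F) (fmap_proper_filter _ PF).
  by apply: (@filterE _ F) => x; exact: set_valP.
exists (exist _ p (mem_set Bp)); split => // P Q FP.
move=> [_ [/= [W oW <-]] Wp WQ].
have [|_ [[x Px <-] Wx]] := Fp (set_val @` P) W _ (open_nbhs_nbhs (conj oW Wp)).
  by rewrite nbhs_simpl /=; apply: filterS FP => x Px; exists x.
by exists x; split => //; exact: WQ.
Qed.

End SetType.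

Lemma prod_hausdorff {T U : topologicalType} :
  hausdorff_space T -> hausdorff_space U -> hausdorff_space (T * U)%type.
Proof.
move=> hT hU [x s] [y t] xy; congr (_, _).
  apply: hT => P Q Px Qy.
  have [z [Pz Qz]] := xy (fst @^-1` P) (fst @^-1` Q) (cvg_fst Px) (cvg_fst Qy).
  by exists z.1.
apply: hU => P Q Px Qy.
have [z [Pz Qz]] := xy (snd @^-1` P) (snd @^-1` Q) (cvg_snd Px) (cvg_snd Qy).
by exists z.2.
Qed.

Lemma continuous_pair {T U V : topologicalType} (f : T -> U) (g : T -> V) :
  continuous f -> continuous g -> continuous (fun t => (f t, g t)).
Proof. by move=> cf cg t; exact: (cvg_pair (cf t) (cg t)). Qed.

Section Subshift.
Context {A : uniformType}.
Hypothesis A_compact : compact [set: A].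
Variable rho : A -> nonempty_word A.
Variable L : nat.
Hypothesis rho_length : constant_length rho L.
Hypothesis L_gt1 : (1 < L)%N.

Local Notation S := {ptws int -> A}.
Local Notation X := (subshift rho).
Local Notation col := (iter_column rho L).

Lemma subshift_shift_by k x : X x -> X (shift_by k x).
Proof.
move=> Xx i n; have := Xx (i + k) n; congr (language rho (existT _ n _)).
by apply/funext => j; rewrite /shift_by addrAC.
Qed.

Lemma closed_subshift : closed X.
Proof.
pose W i n (x : S) : word A := existT (fun m => {ptws 'I_m -> A}) n
  (fun j : 'I_n => x (i + j%:Z)).
have cW i n : continuous (W i n).
  move=> x; apply: (@continuous_comp S {ptws 'I_n -> A} (word A)
    (fun x (j : 'I_n) => x (i + j%:Z)) (existT (fun m => {ptws 'I_m -> A}) n)).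
    by apply: continuous_ptws => j; exact: continuous_ptws_eval.
  exact: existT_continuous.
rewrite (_ : X = \bigcap_i \bigcap_n (W i n @^-1` language rho)); last first.
  by apply/seteqP; split => x Xx; [move=> i _ n _; exact: Xx|move=> i n; exact: Xx].
apply: closed_bigI => i _; apply: closed_bigI => n _.
by apply: preimage_closed => //; exact: closed_closure.
Qed.

Lemma compact_subshift : compact X.
Proof.
exact: subclosed_compact closed_subshift (compact_sequences A_compact) _.
Qed.

Lemma subshift_nonempty (a : A) : X !=set0.
Proof.
(* [x k] carries the word [rho^k(a)] centred at the origin. *)
pose x k : S := fun i => col k `|(i + (L ^ k)./2%:Z)%R|%N a.
have gen i n : \forall k \near \oo, language rho
    (existT (fun m => {ptws 'I_m -> A}) n (fun j : 'I_n => x k (i + j%:Z))).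
  (* As [k < L ^ k], half the length of [rho^k(a)] exceeds [|i| + n], so the window of length [n] at
     [i] lies inside the centred word. *)
  exists (2 * (`|i| + n)).+1 => // k /= kn; apply: subset_closure.
  exists k, a; rewrite /letters /=.
  have kL : (k < L ^ k)%N by exact: ltn_expl.
  pose s := `|(i + (L ^ k)./2%:Z)%R|%N.
  have sE : Posz s = i + (L ^ k)./2%:Z.
    by rewrite gez0_abs//; have := odd_double_half (L ^ k); lia.
  have sn : (s + n <= L ^ k)%N by have := odd_double_half (L ^ k); lia.
  apply/infixP; exists (take s (subst_iter rho k a)), (drop (s + n) (subst_iter rho k a)).
  rewrite addnC -drop_drop -{1}(cat_take_drop s (subst_iter rho k a)); congr (_ ++ _).
  rewrite -{1}(cat_take_drop n (drop s _)); congr (_ ++ _).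
  apply: (@eq_from_nth _ a).
    rewrite size_take size_drop (size_subst_iter rho_length) size_map size_enum_ord.
    by case: ltnP; lia.
  move=> j; rewrite size_take size_drop (size_subst_iter rho_length) => jn.
  have {}jn : (j < n)%N by move: jn; case: ifP; lia.
  rewrite nth_take// nth_drop (nth_subst_iter rho_length); last by lia.
  rewrite (nth_map (Ordinal jn)) ?size_enum_ord//.
  rewrite /x nth_enum_ord//; congr col.
  by have -> : i + j%:Z + (L ^ k)./2%:Z = Posz (s + j) by rewrite PoszD sE; lia.
have PF : ProperFilter (x @ \oo) by exact: fmap_proper_filter.
have [y [_ cy]] := compact_sequences A_compact PF filterT.
(* For each window, all late [x k] lie in the closed set of sequences whose window is in the
   language, so the cluster point [y] does too. *)
exists y => i n.
pose W (x : S) : word A := existT (fun m => {ptws 'I_m -> A}) n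
  (fun j : 'I_n => x (i + j%:Z)).
have cW : continuous W.
  move=> z; apply: (@continuous_comp S {ptws 'I_n -> A} (word A)
    (fun x (j : 'I_n) => x (i + j%:Z)) (existT (fun m => {ptws 'I_m -> A}) n)).
    by apply: continuous_ptws => j; exact: continuous_ptws_eval.
  exact: existT_continuous.
have cl : closed (W @^-1` language rho).
  by apply: preimage_closed => //; exact: closed_closure.
by apply: cl => V Vy; exact: cy (gen i n) Vy.
Qed.

End Subshift.

(** * The tiling space as the quotient of the suspension by deck transformations *)

Section Suspension.
Context {R : realType} {A : uniformType}.
Hypothesis A_compact : compact [set: A].
Hypothesis A_hausdorff : hausdorff_space A.
Variable rho : A -> nonempty_word A.
Variables (l : A -> R) (c : R).
Hypothesis c_gt0 : 0 < c.
Hypothesis lE : forall a, l a = c.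

Local Notation X := (subshift rho).
Local Notation susp := (@suspension R A rho).
Local Notation Omega := (tiling_space rho l).
Local Notation class := (@tiling_class R A rho l).

Definition subshift_by (k : int) (x : X) : X :=
  exist _ (shift_by k (set_val x)) (mem_set (@subshift_shift_by A rho k _ (set_valP x))).

(* The equivalence classes of the suspension are the orbits of [deck]. *)
Definition deck (k : int) (p : susp) : susp :=
  (subshift_by k p.1, p.2 - k%:~R * c).

Lemma subshift_byD k j x : subshift_by k (subshift_by j x) = subshift_by (k + j) x.
Proof. by apply: val_inj; exact: shift_byD. Qed.

Lemma subshift_by0 x : subshift_by 0 x = x.
Proof. by apply: val_inj; exact: shift_by0. Qed.

Lemma deckD k j p : deck k (deck j p) = deck (k + j) p.
Proof.
rewrite /deck /= subshift_byD; congr (_, _).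
by rewrite intrD; ring.
Qed.

Lemma deck0 p : deck 0 p = p.
Proof. by case: p => x s; rewrite /deck /= subshift_by0 mul0r subr0. Qed.

Lemma suspension_stepE p q : suspension_step l p q <-> q = deck 1 p.
Proof.
case: p q => [x s] [y t]; rewrite /suspension_step /deck /= lE; split.
  move=> [yE ->]; congr (_, _); first exact: val_inj.
  by rewrite mulr1z mul1r addrK.
by move=> [-> ->]; rewrite mul1r subrK.
Qed.

Lemma suspension_relE p q : suspension_rel l p q <-> exists k, q = deck k p.
Proof.
split.
  move=> /asboolP; elim=> {p q}.
  - by move=> p q /suspension_stepE ->; exists 1.
  - by move=> p; exists 0; rewrite deck0.
  - by move=> p q _ [k ->]; exists (- k); rewrite deckD addNr deck0.
  - by move=> p q r _ [k ->] _ [j ->]; exists (j + k); rewrite deckD.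
have H (n : nat) r : clos_refl_sym_trans _ (suspension_step l) r (deck n%:Z r).
  elim: n => [|n ih]; first by rewrite deck0; exact: rst_refl.
  apply: rst_trans ih _; apply: rst_step; apply/suspension_stepE.
  by rewrite deckD -PoszD.
move=> [k ->]; apply/asboolP; have [k0|k0] := leP 0 k.
  by rewrite -(gez0_abs k0); exact: H.
apply: rst_sym; have := H `|k|%N (deck k p).
by rewrite deckD ltz0_abs// addNr deck0.
Qed.

Lemma tiling_class_eq p q : class p = class q <-> exists k, q = deck k p.
Proof.
rewrite -suspension_relE; split.
  by move=> /eqmodP.
by move=> pq; apply/eqmodP.
Qed.

Lemma tiling_class_deck k p : class (deck k p) = class p.
Proof. by apply/esym/tiling_class_eq; exists k. Qed.

Lemma tiling_class_surj w : exists p, class p = w.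
Proof. by exists (repr w); rewrite /tiling_class reprK. Qed.

Lemma continuous_tiling_class : continuous class.
Proof. exact: pi_continuous. Qed.

Lemma continuous_subshift_by k : continuous (subshift_by k).
Proof.
apply: continuous_set_type => x.
apply: (@continuous_comp X {ptws int -> A} {ptws int -> A} set_val (shift_by k)).
  exact: initial_continuous.
exact: continuous_shift_by.
Qed.

Lemma continuous_deck k : continuous (deck k).
Proof.
apply: continuous_pair => p.
  apply: (@continuous_comp _ _ _ fst (subshift_by k)); first exact: cvg_fst.
  exact: continuous_subshift_by.
by apply: cvgB; [exact: cvg_snd|exact: cvg_cst].
Qed.

(** A quotient by a group action has an open projection: the saturation of an open set is the union
    of its preimages under the maps [deck k]. *)
Lemma nbhs_tiling_class p (U : set susp) : nbhs p U -> nbhs (class p) (class @` U).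
Proof.
rewrite nbhsE => -[V [oV Vp] VU]; rewrite nbhsE.
exists (class @` V); last by move=> _ [q Vq <-]; exists q => //; exact: VU.
split; last by exists p.
rewrite /open /= /quotient_open.
rewrite (_ : _ @^-1` _ = \bigcup_k (deck k @^-1` V)).
  by apply: bigcup_open => k _; apply: open_comp => // q _; exact: continuous_deck.
apply/seteqP; split => q /=.
  by move=> [r Vr /esym/tiling_class_eq[k rE]]; exists k => //=; rewrite -rE.
by move=> [k _ Vk]; exists (deck k q) => //; exact: tiling_class_deck.
Qed.

(** The deck action is properly discontinuous: [deck k] moves the real coordinate by [k * c], so
    near two given points only [|k| <= K] matters, and these finitely many [k] are separated one at
    a time. *)
Lemma tiling_space_hausdorff : hausdorff_space Omega.
Proof.
have hS : hausdorff_space susp.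
  apply: prod_hausdorff; last exact: Rhausdorff.
  by apply: set_type_hausdorff; apply: hausdorff_product.
move=> w1 w2 w12; apply: contrapT => w1w2.
have [p pE] := tiling_class_surj w1; have [q qE] := tiling_class_surj w2.
have pq k : deck k p <> q.
  by move=> dpq; apply: w1w2; rewrite -pE -qE -dpq tiling_class_deck.
have sep k : \forall pq \near (p, q), deck k pq.1 <> pq.2.
  have : deck k p != q by apply/eqP.
  have := hS; rewrite open_hausdorff => /[apply].
  move=> [[U V] /= [Up Vq] [oU oV UV]].
  exists (deck k @^-1` U, V).
    split => /=; first apply: continuous_deck; apply: open_nbhs_nbhs; split => //.
      exact: set_mem.
    exact: set_mem.
  move=> [p' q'] [/= Up' Vq'] E; have : (U `&` V) q' by split => //; rewrite -E.
  by move/eqP: UV => ->.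
(* The summand 2 allows each of the two real coordinates to move by less than 1. *)
have [K HK] : exists K : nat, `|p.2 - q.2| + 2 < K%:R * c.
  exists (Num.bound ((`|p.2 - q.2| + 2) / c)).
  by rewrite -ltr_pdivrMr// archi_boundP// divr_ge0 ?addr_ge0// ltW.
have near1 : \forall pq \near (p, q), forall k : int, (`|k| <= K)%N ->
    deck k pq.1 <> pq.2.
  apply: (@near_window _ (nbhs (p, q))
    (fun k (pq : susp * susp) => deck k pq.1 <> pq.2)).
  exact: sep.
have near2 : \forall pq \near (p, q), `|p.2 - pq.1.2| < 1 /\ `|q.2 - pq.2.2| < 1.
  have csnd : continuous (snd : susp -> R) by move=> r; exact: cvg_snd.
  have near_snd (r : susp) : \forall p' \near r, `|r.2 - p'.2| < 1.
    by have := csnd r; move=> /cvgrPdist_lt; apply.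
  by exists ([set p' | `|p.2 - p'.2| < 1], [set q' | `|q.2 - q'.2| < 1]);
    [split; exact: near_snd|].
have [[U V] /= [Up Vq] UV] := filterI near1 near2.
rewrite -pE -qE in w12.
have [w [[p' Up' <-] [q' Vq' /esym]]] :=
  w12 _ _ (nbhs_tiling_class Up) (nbhs_tiling_class Vq).
move=> /tiling_class_eq[k q'E].
have [/= nk [sp sq]] := UV (p', q') (conj Up' Vq').
have [kK|Kk] := leqP `|k|%N K; first by apply: (nk k kK); rewrite q'E.
have : `|p'.2 - q'.2| = `|k|%N%:R * c.
  rewrite q'E /= opprB addrC subrK normrM (gtr0_norm c_gt0) -intr_norm.
  by congr (_ * _); rewrite -abszE.
have : `|p'.2 - q'.2| < K%:R * c.
  apply: le_lt_trans HK.
  have -> : p'.2 - q'.2 = (p.2 - q.2) - (p.2 - p'.2) + (q.2 - q'.2) by ring.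
  apply: le_trans (ler_normD _ _) _.
  have := ler_normB (p.2 - q.2) (p.2 - p'.2); lra.
move=> + E; rewrite E ltr_pM2r// ltr_nat => /(ltn_trans Kk).
by rewrite ltnn.
Qed.

Lemma tiling_class_fundamental w : exists x s, [/\ 0 <= s, s < c & class (x, s) = w].
Proof.
have [[x s] <-] := tiling_class_surj w.
pose k := Num.floor (s / c); exists (subshift_by k x), (s - k%:~R * c); split.
- rewrite subr_ge0 -ler_pdivlMr//; exact: floor_le_tmp.
- have : s / c < k%:~R + 1 by rewrite -[1](mulr1z 1) -intrD floorD1_gt.
  by rewrite ltr_pdivrMr// mulrDl mul1r; lra.
- exact: (tiling_class_deck k (x, s)).
Qed.

Lemma compact_tiling_space : compact [set: Omega].
Proof.
have cK : compact ([set: X] `*` `[0, c]%classic).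
  apply: compact_setX; last exact: segment_compact.
  apply: set_type_compact.
  exact: (compact_subshift A_compact).
have := continuous_compact (continuous_subspaceT continuous_tiling_class) cK.
congr compact; apply/seteqP; split => // w _.
have [x [s [s0 sc <-]]] := tiling_class_fundamental w.
by exists (x, s) => //; split => //=; rewrite in_itv /= s0 ltW.
Qed.

Lemma translate0 (w : Omega) : translate 0 w = w.
Proof. by have [[x s] <-] := tiling_class_surj w; rewrite translateE subr0. Qed.

Lemma translateD s t (w : Omega) :
  translate s (translate t w) = translate (s + t) w.
Proof.
have [[x u] <-] := tiling_class_surj w; rewrite !translateE.
by congr (class (_, _)); ring.
Qed.

Lemma continuous_translate t : continuous (@translate R A rho l t).
Proof.
apply/quotient_continuous.
rewrite (_ : _ \o _ = class \o (fun p : susp => (p.1, p.2 - t))); last first.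
  by apply/funext => -[x s]; exact: translateE.
move=> p; apply: continuous_comp; last exact: continuous_tiling_class.
apply: (continuous_pair (f := fst) (g := fun p : susp => p.2 - t)) => q.
  exact: cvg_fst.
by apply: cvgB; [exact: cvg_snd|exact: cvg_cst].
Qed.

End Suspension.

Lemma sum_mod_shift {R : zmodType} (f : nat -> R) (r J : nat) : (r <= J)%N ->
  \sum_(0 <= i < J) f ((r + i) %% J)%N = \sum_(0 <= i < J) f i.
Proof.
move=> rJ; rewrite (@big_cat_nat _ _ _ (J - r)) ?leq_subr//=.
rewrite [RHS](@big_cat_nat _ _ _ r)//= addrC; congr (_ + _).
  rewrite -{1}[(J - r)%N]add0n big_addn subKn//.
  apply: eq_big_nat => i /andP[_ ir].
  have -> : (r + (i + (J - r)) = i + J)%N by lia.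
  by rewrite modnDr modn_small// (leq_trans ir).
rewrite -[in RHS](add0n r) big_addn; apply: eq_big_nat => i /andP[_ iJ].
by rewrite addnC modn_small//; lia.
Qed.

(** * Small oscillation of grid averages on the tiling space *)

Section TilingAverages.
Context {R : realType} {A : uniformType}.
Hypothesis A_compact : compact [set: A].
Hypothesis A_hausdorff : hausdorff_space A.
Variable rho : A -> nonempty_word A.
Hypothesis rho_continuous : continuous rho.
Hypothesis rho_primitive : primitive rho.
Variable L : nat.
Hypothesis rho_length : constant_length rho L.
Hypothesis rho_equicontinuous :
  uniformly_equicontinuous (column_semigroup rho L).
Hypothesis L_gt1 : (1 < L)%N.
Variables (l : A -> R) (c : R).
Hypothesis c_gt0 : 0 < c.
Hypothesis lE : forall a, l a = c.

Local Notation X := (subshift rho).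
Local Notation S := {ptws int -> A}.
Local Notation susp := (@suspension R A rho).
Local Notation Omega := (tiling_space rho l).
Local Notation class := (@tiling_class R A rho l).
Local Notation transl := (@translate R A rho l).

(** Tietze extension: fibre functions live on the subshift, while [subshift_birkhoff] takes
    observables on all sequences. *)
Lemma subshift_extension (g : X -> R) : continuous g ->
  exists2 G : S -> R, continuous G & forall x : X, G (set_val x) = g x.
Proof.
move=> cg.
have nS : normal_space S.
  by apply: compact_normal; [exact: hausdorff_product|exact: compact_sequences].
have cX : compact [set: X] by exact/set_type_compact/compact_subshift.
have [M M0 gM] := compact_bounded_fun cX cg.
have valE (x : X) : valL_ 0 g (set_val x) = g x.
  exact: (congr1 (fun h => h x) (valLK 0 g)).
have [|x Xx|G [GE cG _]] := @continuous_bounded_extension S R nS X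
    (closed_subshift (rho := rho)) (valL_ 0 g) M M0.
- exact/subspace_valL_continuousP'.
- by have := gM (exist _ x (mem_set Xx)); rewrite -valE.
exists G => // x; rewrite -valE; apply/esym/GE/mem_set; exact: set_valP.
Qed.

Lemma birkhoff_multiple (G : S -> R) (d a : R) N M :
  (forall x, X x -> `|\sum_(0 <= j < N) G (shift_by j%:Z x) - N%:R * a| <= N%:R * d) ->
  forall x, X x ->
    `|\sum_(0 <= j < M * N) G (shift_by j%:Z x) - (M * N)%:R * a| <= (M * N)%:R * d.
Proof.
move=> H x Xx; rewrite big_nat_blocks.
have cstE (z : R) : (M * N)%:R * z = \sum_(0 <= k < M) N%:R * z.
  by rewrite sumr_const_nat subn0 natrM -mulrA [LHS]mulr_natl.
rewrite !cstE -sumrB; apply: le_trans (ler_norm_sum _ _ _) _.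
apply: ler_sum => k _; have := H _ (subshift_shift_by (k := (k * N)%N%:Z) Xx).
by under eq_bigr do rewrite shift_byD -PoszD addnC.
Qed.

(** The product of the individual lengths is a multiple of each, and an estimate uniform in [x]
    passes to multiples by cutting the orbit into consecutive stretches. *)
Lemma common_birkhoff (g : nat -> X -> R) J (d : R) : 0 < d ->
  (forall r, continuous (g r)) -> exists N (a : nat -> R), (0 < N)%N /\
    forall r (x : X), (r < J)%N ->
      `|\sum_(0 <= j < N) g r (subshift_by j%:Z x) - N%:R * a r| <= N%:R * d.
Proof.
move=> d0 cg.
have /choice[G HG] : forall r, exists G : S -> R,
    continuous G /\ forall x : X, G (set_val x) = g r x.
  by move=> r; have [G cG GE] := subshift_extension (cg r); exists G.
have /choice[n /choice[a Ha]] : forall r, exists n a, (0 < n)%N /\ forall x, X x ->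
    `|\sum_(0 <= j < n) G r (shift_by j%:Z x) - n%:R * a| <= n%:R * d.
  move=> r; have [cG _] := HG r.
  exact: (subshift_birkhoff A_compact rho_continuous rho_primitive rho_length
    rho_equicontinuous L_gt1 cG d0).
exists (\prod_(r < J) n r)%N, a; split.
  by apply: prodn_gt0 => r; have [] := Ha r.
move=> r x rJ; have [_ Hr] := Ha r; have [_ GE] := HG r.
have /dvdnP[M ->] : (n r %| \prod_(r < J) n r)%N.
  by rewrite (bigD1 (Ordinal rJ))//= dvdn_mulr.
have := birkhoff_multiple M Hr (set_valP x).
by under [X in `|X - _|]eq_bigr do rewrite -[shift_by _ _]/(set_val (subshift_by _ x)) GE.
Qed.

Lemma translate_unif_continuous (F : Omega -> R) (d : R) : continuous F -> 0 < d ->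
  exists2 e : R, 0 < e & forall t w, `|t| < e -> `|F (transl t w) - F w| <= d.
Proof.
move=> cF d0; pose P (t : R) w : Prop := `|F (transl t w) - F w| <= d.
have /compact_near_coveringP cov : compact [set: Omega].
  exact: compact_tiling_space c_gt0 lE.
have : \forall t \near (0 : R), [set: Omega] `<=` P t.
  apply: (cov R (nbhs (0 : R)) P _) => w _; have [p <-] := tiling_class_surj w.
  (* Joint continuity in time and tiling is obtained on the suspension; openness of the projection
     carries the neighbourhood down. *)
  pose f (z : susp * R) := F (class (z.1.1, z.1.2 - z.2)) - F (class z.1).
  have cf : continuous f.
    apply: continuous_subf => z; last first.
      apply: (@continuous_comp _ _ _ (fun z : susp * R => class z.1) F); last exact: cF.
      apply: continuous_comp; first exact: cvg_fst.
      exact: continuous_tiling_class.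
    apply: (@continuous_comp _ _ _
      (fun z : susp * R => class (z.1.1, z.1.2 - z.2)) F); last exact: cF.
    apply: (@continuous_comp _ _ _
      (fun z : susp * R => (z.1.1, z.1.2 - z.2) : susp) class); last first.
      exact: continuous_tiling_class.
    apply: (continuous_pair (f := fun z : susp * R => z.1.1)
      (g := fun z : susp * R => z.1.2 - z.2)) => y.
      by apply: (@continuous_comp _ _ _ fst fst); exact: cvg_fst.
    apply: cvgB; last exact: cvg_snd.
    by apply: (@continuous_comp _ _ _ fst snd); [exact: cvg_fst|exact: cvg_snd].
  pose z0 : susp * R := (p, 0).
  have f0 : f z0 = 0 by rewrite /f /= subr0 -surjective_pairing subrr.
  have /cvgrPdist_le/(_ _ d0)[[U V] /= [Up V0] UV] := cf z0.
  exists (class @` U, V); first by split => //=; exact: nbhs_tiling_class.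
  move=> [_ t] [/= [q Uq <-] Vt]; have := UV (q, t) (conj Uq Vt).
  rewrite /= f0 sub0r normrN /f /= /P; case: q {Uq} => x s.
  by rewrite translateE.
move=> /nbhs_ballP[e /= e0 He]; exists e => // t w te; apply: He => //.
by rewrite /ball /= sub0r normrN.
Qed.

Lemma tiling_small_osc (F : Omega -> R) : continuous F ->
  forall e : R, 0 < e -> exists2 ts, (0 < size ts)%N &
    forall v w, act_avg transl ts F v - act_avg transl ts F w <= e.
Proof.
(* Each average is within [2 * d] of one constant: [d] for rounding the height to the grid, [d] for
   the Birkhoff sums. *)
move=> cF e e_gt0; pose d := e / 4; have d0 : 0 < d by rewrite divr_gt0.
have [h h0 Hh] := translate_unif_continuous cF d0.
have [J J0 Jh] : exists2 J, (0 < J)%N & c / J%:R < h.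
  exists (Num.bound (c / h)).+1 => //.
  rewrite ltr_pdivrMr ?ltr0n// mulrC -ltr_pdivrMr//.
  apply: lt_trans (archi_boundP _) _; last by rewrite ltr_nat.
  by rewrite divr_ge0// ltW.
have JR0 : 0 < J%:R :> R by rewrite ltr0n.
pose u := c / J%:R; have u0 : 0 < u by rewrite divr_gt0.
have Ju : J%:R * u = c by rewrite mulrC divfK// gt_eqF.
pose g k (x : X) := F (class (x, k%:R * u)).
have cg k : continuous (g k).
  move=> x; apply: (@continuous_comp _ _ _ (fun x : X => class (x, k%:R * u)) F).
    apply: (@continuous_comp _ _ _ (fun x : X => (x, k%:R * u) : susp) class).
      by apply: continuous_pair; [move=> y; exact: cvg_id|exact: continuous_cst_fun].
    exact: continuous_tiling_class.
  exact: cF.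
(* Moving by [J * u = c] along the fibre amounts to shifting [x]. *)
have gJ k m x : g (m * J + k)%N x = g k (subshift_by m%:Z x).
  rewrite /g -(tiling_class_deck lE m%:Z (x, _)) /deck /=.
  by congr (F (class (_, _))); rewrite natrD natrM -Ju; ring.
have [N [a [N0 Ha]]] := common_birkhoff J d0 cg.
have NR0 : 0 < N%:R :> R by rewrite ltr0n.
(* Translation by [t] subtracts [t], so negative times move up the fibre; the grid runs through [N]
   tiles with [J] points in each. *)
exists [seq - (k%:R * u) | k <- iota 0 (N * J)].
  by rewrite size_map size_iota muln_gt0 N0.
set ts := map _ _; pose C := (\sum_(0 <= r < J) a r) / J%:R.
suff Havg w : `|act_avg transl ts F w - C| <= 2 * d.
  move=> v w; have := Havg v; have := Havg w; rewrite !ler_norml.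
  have -> : e = 4 * d by rewrite /d; field.
  by move=> /andP[? ?] /andP[? ?]; lra.
have [x [s [s0 sc <-]]] := tiling_class_fundamental c_gt0 lE w.
have [r0 r0J [s1 s1u sE]] : exists2 r0, (r0 <= J)%N &
    exists2 s1, `|s1| <= u & s = r0%:R * u + s1.
  have su : 0 <= s / u by rewrite divr_ge0// ltW.
  have /andP[lo hi] := truncn_itv su; exists (Num.trunc (s / u)).
    rewrite -(ler_nat R); apply: le_trans lo _.
    by rewrite ler_pdivrMr// Ju ltW.
  exists (s - (Num.trunc (s / u))%:R * u); last by rewrite addrC subrK.
  move: lo hi; rewrite -natr1 ler_pdivlMr// ltr_pdivrMr// mulrDl mul1r => ? ?.
  by rewrite ger0_norm; lra.
have avgE : act_avg transl ts F (class (x, s)) =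
    (\sum_(0 <= k < N * J) F (class (x, s + k%:R * u))) / (N * J)%:R.
  rewrite /act_avg /ts size_map size_iota big_map -{1}[(N * J)%N]subn0.
  congr (_ / _); apply: eq_bigr => k _.
  by rewrite translateE opprK.
have NJ0 : 0 < (N * J)%:R :> R by rewrite ltr0n muln_gt0 N0.
have H1 : `|\sum_(0 <= k < N * J) F (class (x, s + k%:R * u)) -
    \sum_(0 <= k < N * J) g (r0 + k)%N x| <= (N * J)%:R * d.
  rewrite -sumrB; apply: le_trans (ler_norm_sum _ _ _) _.
  apply: (@le_trans _ _ (\sum_(0 <= k < N * J) d)); last first.
    by rewrite sumr_const_nat subn0 [X in _ <= X]mulr_natl.
  apply: ler_sum => k _; rewrite /g.
  have -> : class (x, s + k%:R * u) = transl (- s1) (class (x, (r0 + k)%:R * u)).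
    by rewrite translateE opprK; congr (class (_, _)); rewrite natrD sE; ring.
  by apply: Hh; rewrite normrN; exact: le_lt_trans s1u Jh.
have H2 : `|\sum_(0 <= k < N * J) g (r0 + k)%N x - (N * J)%:R * C| <= (N * J)%:R * d.
  (* Sort by the residue of [k] modulo [J]. Each class is a Birkhoff sum from a shifted point, which
     uniformity in [x] permits; adding [r0] only permutes the residues, so [C] does not depend on
     the starting height. *)
  rewrite big_nat_blocks exchange_big /=.
  have -> : (N * J)%:R * C = \sum_(0 <= r < J) N%:R * a ((r0 + r) %% J)%N.
    rewrite -mulr_sumr sum_mod_shift// /C natrM; field; exact: lt0r_neq0.
  have -> : (N * J)%:R * d = \sum_(0 <= r < J) N%:R * d.
    by rewrite sumr_const_nat subn0 natrM mulrAC [LHS]mulr_natr.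
  rewrite -sumrB; apply: le_trans (ler_norm_sum _ _ _) _.
  apply: ler_sum => r _; set r1 := ((r0 + r) %% J)%N.
  have r1J : (r1 < J)%N by rewrite ltn_pmod.
  have := Ha r1 (subshift_by ((r0 + r) %/ J)%N%:Z x) r1J.
  rewrite (_ : \sum_(0 <= j < N) g r1 _ = \sum_(0 <= j < N) g (r0 + (j * J + r))%N x)//.
  apply: eq_bigr => j _; rewrite subshift_byD -PoszD -gJ; congr (g _ x).
  by rewrite mulnDl -addnA -divn_eq addnCA.
rewrite avgE -(ler_pM2l NJ0) -[X in X * `|_|]gtr0_norm// -normrM mulrBr.
rewrite [X in `|X - _|]mulrC divfK ?gt_eqF//.
apply: le_trans (ler_distD (\sum_(0 <= k < N * J) g (r0 + k)%N x) _ _) _.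
by have := lerD H1 H2; congr (_ <= _); ring.
Qed.

Lemma tiling_uniquely_ergodic (a : A) : uniquely_ergodic (translate (l := l) (rho := rho)).
Proof.
have [x Xx] := subshift_nonempty A_compact rho_length L_gt1 a.
pose x0 : X := exist _ x (mem_set Xx).
apply: (@uniquely_ergodic_of_averages R Omega transl _ _ _ _ _ _ (class (x0, 0))).
- exact: compact_tiling_space c_gt0 lE.
- exact: tiling_space_hausdorff c_gt0 lE.
- exact: translate0.
- exact: translateD.
- exact: continuous_translate.
- exact: tiling_small_osc.
Qed.

End TilingAverages.

Theorem theorem6p18 (R : realType) (A : uniformType)
  (A_compact : compact [set: A]) (A_hausdorff : hausdorff_space A)
  (rho : A -> nonempty_word A) (rho_continuous : continuous rho)
  (rho_growing : exists a : A, (2 <= size (subst_letter rho a))%N)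
  (rho_primitive : primitive rho)
  (L : nat) (rho_length : constant_length rho L)
  (Phi_equicontinuous : uniformly_equicontinuous (column_semigroup rho L)) :
  let r : R := spectral_radius (subst_op rho) in
  strongly_power_convergent
    (fun (f : A -> R) (a : A) => subst_op rho f a / r) /\
  (forall l : A -> R, natural_length rho l ->
    uniquely_ergodic (@translate R A rho l)).
Proof.
(* The growing letter supplies both [1 < L] and an inhabitant of the alphabet. *)
have [a aL] := rho_growing; rewrite rho_length in aL.
rewrite /= (spectral_radius_constant_length A_compact rho_continuous rho_length a).
split; first exact: subst_op_strongly_power_convergent.
move=> l /(natural_length_constant A_compact rho_primitive rho_length
  Phi_equicontinuous)[c c_gt0 lE].
exact: (tiling_uniquely_ergodic A_compact A_hausdorff rho_continuous
  rho_primitive rho_length Phi_equicontinuous aL c_gt0 lE a).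
Qed.
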